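(* Let $C\subset\mathbb P^2$ be a reduced curve over $\mathbb C$, let $c_v$ be the number of its virtual cusps and $n_v$ the number of its virtual nodes. Then: (i) $c_v\geq 0$ and $n_v\geq 0$; (ii) if $C$ is a cuspidal curve, then $c_v$ and $n_v$ are equal, respectively, to the number $c$ of ordinary cusps and the number $n$ of (ordinary) nodes of $C$.
   Context: All curves are over $\mathbb C$. A reduced curve $C\subset\mathbb P^2$ is called cuspidal if its only singular points are ordinary cusps (locally analytically $x^2=y^3$) and ordinary nodes (locally analytically $xy=0$). Let $(C,p)\subset(\mathbb P^2,p)$ be a germ of a reduced plane curve singularity, decomposed into irreducible germs (branches) $(C,p)=(C_1,p)\cup\dots\cup(C_k,p)$; let $m_i$ be the multiplicity of $(C_i,p)$ at $p$ and let $\delta_p$ be the $\delta$-invariant of $(C,p)$ (the dimension over $\mathbb C$ of the quotient of the normalization of $\mathcal O_{C,p}$ by $\mathcal O_{C,p}$). The number of virtual cusps and the number of virtual nodes of $(C,p)$ are $$c_{v,p}:=\sum_{i=1}^k(m_i-1),\qquad n_{v,p}:=\delta_p-\sum_{i=1}^k(m_i-1).$$ For a reduced curve $C\subset\mathbb P^2$ with set of singular points $\mathrm{Sing}\,C$, the number of virtual cusps and the number of virtual nodes of $C$ are $$c_v:=\sum_{p\in\mathrm{Sing}\,C}c_{v,p},\qquad n_v:=\sum_{p\in\mathrm{Sing}\,C}n_{v,p}.$$ *)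

(* Defs.v *)
From HB Require Import structures.
From mathcomp Require Import all_boot all_order all_algebra.
From mathcomp Require Import finmap complex mpoly.
From mathcomp Require Import boolp classical_sets functions cardinality fsbigop.
From mathcomp Require Import reals ereal.

Set Implicit Arguments.
Unset Strict Implicit.
Unset Printing Implicit Defensive.

Import Order.TTheory GRing.Theory Num.Theory.
Local Open Scope ring_scope.

Section FormalPowerSeries.
Variable K : comNzRingType.

(* [a i j] is the coefficient of x^i y^j. *)
Definition fps2 := nat -> nat -> K.

HB.instance Definition _ := gen_eqMixin fps2.
HB.instance Definition _ := gen_choiceMixin fps2.

Implicit Types a b c : fps2.

Definition fps2_add a b : fps2 := fun i j => a i j + b i j.
Definition fps2_opp a : fps2 := fun i j => - a i j.
Definition fps2_zero : fps2 := fun _ _ => 0.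
Definition fps2_one : fps2 := fun i j => ((i == 0) && (j == 0))%:R.
Definition fps2_mul a b : fps2 := fun i j =>
  \sum_(k < i.+1) \sum_(l < j.+1) a k l * b (i - k)%N (j - l)%N.
Definition fps2_scale (t : K) a : fps2 := fun i j => t * a i j.

Lemma fps2P a b : (forall i j, a i j = b i j) -> a = b.
Proof. by move=> h; apply/funext => i; apply/funext => j. Qed.

Let addA : associative fps2_add.
Proof. by move=> a b c; apply: fps2P => i j; apply: addrA. Qed.
Let addC : commutative fps2_add.
Proof. by move=> a b; apply: fps2P => i j; apply: addrC. Qed.
Let add0 : left_id fps2_zero fps2_add.
Proof. by move=> a; apply: fps2P => i j; apply: add0r. Qed.
Let addN : left_inverse fps2_zero fps2_opp fps2_add.
Proof. by move=> a; apply: fps2P => i j; apply: addNr. Qed.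

HB.instance Definition _ := GRing.isZmodule.Build fps2 addA addC add0 addN.

(* Truncation to a bivariate polynomial; the ring axioms are inherited from
   [{poly {poly K}}] through it. *)
Definition fps2_trunc n a : {poly {poly K}} :=
  \poly_(i < n) \poly_(j < n) a i j.

Lemma coef_fps2_trunc n a i j :
  (i < n)%N -> (j < n)%N -> (fps2_trunc n a)`_i`_j = a i j.
Proof. by move=> lin ljn; rewrite /fps2_trunc coef_poly lin coef_poly ljn. Qed.

Lemma coef_mul2 (p q : {poly {poly K}}) i j :
  (p * q)`_i`_j
  = \sum_(k < i.+1) \sum_(l < j.+1) p`_k`_l * q`_(i - k)`_(j - l).
Proof.
by rewrite coefM coef_sum; apply: eq_bigr => k _; rewrite coefM.
Qed.

Lemma fps2_mulE n a b i j (p q : {poly {poly K}}) :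
  (i < n)%N -> (j < n)%N ->
  (forall k l, (k < n)%N -> (l < n)%N -> p`_k`_l = a k l) ->
  (forall k l, (k < n)%N -> (l < n)%N -> q`_k`_l = b k l) ->
  (p * q)`_i`_j = fps2_mul a b i j.
Proof.
move=> lin ljn hp hq; rewrite coef_mul2; apply: eq_bigr => k _.
apply: eq_bigr => l _; rewrite hp ?hq //.
- by rewrite (leq_ltn_trans _ lin) // leq_subr.
- by rewrite (leq_ltn_trans _ ljn) // leq_subr.
- by rewrite (leq_ltn_trans _ lin) // -ltnS.
- by rewrite (leq_ltn_trans _ ljn) // -ltnS.
Qed.

Let mulA : associative fps2_mul.
Proof.
move=> a b c; apply: fps2P => i j.
pose n := (maxn i j).+1.
have lin : (i < n)%N by rewrite ltnS leq_maxl.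
have ljn : (j < n)%N by rewrite ltnS leq_maxr.
pose t := fps2_trunc n; have tE := @coef_fps2_trunc n.
rewrite -(@fps2_mulE n _ _ _ _ (t a) (t b * t c)) //; last first.
- by move=> k l lk ll; apply: fps2_mulE lk ll _ _ => *; apply: tE.
- by move=> *; apply: tE.
rewrite mulrA (@fps2_mulE n (fps2_mul a b) c) //.
- by move=> k l lk ll; apply: fps2_mulE lk ll _ _ => *; apply: tE.
- by move=> *; apply: tE.
Qed.

Let mulC : commutative fps2_mul.
Proof.
move=> a b; apply: fps2P => i j.
pose n := (maxn i j).+1.
have lin : (i < n)%N by rewrite ltnS leq_maxl.
have ljn : (j < n)%N by rewrite ltnS leq_maxr.
pose t := fps2_trunc n; have tE := @coef_fps2_trunc n.
rewrite -(@fps2_mulE n _ _ _ _ (t a) (t b)) //; try by move=> *; apply: tE.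
by rewrite mulrC; apply: fps2_mulE lin ljn _ _ => *; apply: tE.
Qed.

Let mul1 : left_id fps2_one fps2_mul.
Proof.
move=> a; apply: fps2P => i j.
rewrite /fps2_mul big_ord_recl [X in _ + X]big1; last first.
  by move=> k _; apply: big1 => l _; rewrite /fps2_one /= mul0r.
rewrite addr0 big_ord_recl [X in _ + X]big1; last first.
  by move=> l _; rewrite /fps2_one /= mul0r.
by rewrite /fps2_one /= mul1r addr0 !subn0.
Qed.

Let mulDl : left_distributive fps2_mul fps2_add.
Proof.
move=> a b c; apply: fps2P => i j; rewrite /fps2_mul /fps2_add -big_split /=.
apply: eq_bigr => k _; rewrite -big_split /=; apply: eq_bigr => l _.
exact: mulrDl.
Qed.

Let one_neq0 : fps2_one != fps2_zero.
Proof.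
apply/eqP => /(congr1 (fun a : fps2 => a 0%N 0%N)).
by move/eqP; rewrite /fps2_one /fps2_zero /= oner_eq0.
Qed.

HB.instance Definition _ :=
  GRing.Zmodule_isComNzRing.Build fps2 mulA mulC mul1 mulDl one_neq0.

Let scaleA t u a : fps2_scale t (fps2_scale u a) = fps2_scale (t * u) a.
Proof. by apply: fps2P => i j; apply: mulrA. Qed.
Let scale1 : left_id 1 fps2_scale.
Proof. by move=> a; apply: fps2P => i j; apply: mul1r. Qed.
Let scaleDr : right_distributive fps2_scale +%R.
Proof. by move=> t a b; apply: fps2P => i j; apply: mulrDr. Qed.
Let scaleDl a : {morph fps2_scale^~ a : t u / t + u}.
Proof. by move=> t u; apply: fps2P => i j; apply: mulrDl. Qed.

HB.instance Definition _ :=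
  GRing.Zmodule_isLmodule.Build K fps2 scaleA scale1 scaleDr scaleDl.

Let scaleAl t (a b : fps2) : t *: (a * b) = t *: a * b.
Proof.
apply: fps2P => i j; rewrite /GRing.scale /GRing.mul /= /fps2_scale /fps2_mul.
rewrite mulr_sumr; apply: eq_bigr => k _; rewrite mulr_sumr.
by apply: eq_bigr => l _; apply: mulrA.
Qed.

HB.instance Definition _ := GRing.Lmodule_isLalgebra.Build K fps2 scaleAl.
HB.instance Definition _ := GRing.Lalgebra_isComAlgebra.Build K fps2.

End FormalPowerSeries.

Section ConvergentPowerSeries.
Variable K : numFieldType.

(* By Abel's lemma, a power series converges in a neighbourhood of the origin
   if and only if its terms are bounded at some point (r, r) with r > 0.  (For
   K = R[i], r > 0 means that r is a positive real.) *)
Definition convergent : {pred fps2 K} := fun a => `[<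
  exists2 r : K, 0 < r &
    exists M : K, forall i j, `|a i j| * r ^+ (i + j) <= M >].

Lemma convergent_subalg : subalg_closed convergent.
Proof.
have shrink (a : fps2 K) (r s M : K) : 0 < s -> s <= r ->
    (forall i j, `|a i j| * r ^+ (i + j) <= M) ->
    (forall i j, `|a i j| * s ^+ (i + j) <= M).
  move=> s0 sr h i j; apply: le_trans (h i j); apply: ler_wpM2l => //.
  by apply: lerXn2r => //; rewrite nnegrE ltW // (lt_le_trans s0).
have common (a b : fps2 K) : convergent a -> convergent b ->
    exists2 r : K, 0 < r & exists M N : K,
      (forall i j, `|a i j| * r ^+ (i + j) <= M) /\
      (forall i j, `|b i j| * r ^+ (i + j) <= N).
  move=> /asboolP [r r0 [M hM]] /asboolP [s s0 [N hN]].
  case/orP: (real_leVge (gtr0_real r0) (gtr0_real s0)) => h.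
    by exists r => //; exists M, N; split=> //; apply: shrink hN.
  by exists s => //; exists M, N; split=> //; apply: shrink hM.
split.
- apply/asboolP; exists 1 => //; exists 1 => i j; rewrite expr1n mulr1.
  rewrite /GRing.one /= /fps2_one; case: (_ && _); by rewrite ?normr1 ?normr0.
- move=> t a b ha hb; have [r r0 [M [N [hM hN]]]] := common a b ha hb.
  apply/asboolP; exists r => //; exists (`|t| * M + N) => i j.
  have -> : (t *: a + b) i j = t * a i j + b i j by [].
  apply: (@le_trans _ _ ((`|t| * `|a i j| + `|b i j|) * r ^+ (i + j))).
    apply: ler_wpM2r; first by rewrite exprn_ge0 // ltW.
    by rewrite -normrM ler_normD.
  rewrite mulrDl; apply: lerD => //; rewrite -mulrA.
  by apply: ler_wpM2l.
- move=> a b ha hb; have [r r0 [M [N [hM hN]]]] := common a b ha hb.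
  have M0 : 0 <= M by apply: le_trans (hM 0%N 0%N); rewrite mulr_ge0 // exprn_ge0 // ltW.
  apply/asboolP; exists (r / 2); first by rewrite divr_gt0.
  exists (M * N) => i j; have -> : (a * b) i j = fps2_mul a b i j by [].
  rewrite expr_div_n mulrA ler_pdivrMr ?exprn_gt0 //.
  have bnd : `|fps2_mul a b i j| * r ^+ (i + j)
      <= \sum_(k < i.+1) \sum_(l < j.+1) (M * N).
    apply: le_trans (_ : (\sum_(k < i.+1) \sum_(l < j.+1)
        `|a k l| * `|b (i - k)%N (j - l)%N|) * r ^+ (i + j) <= _).
      apply: ler_wpM2r; first by rewrite exprn_ge0 // ltW.
      apply: le_trans (ler_norm_sum _ _ _) _; apply: ler_sum => k _.
      apply: le_trans (ler_norm_sum _ _ _) _; apply: ler_sum => l _.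
      by rewrite normrM.
    rewrite mulr_suml; apply: ler_sum => k _.
    rewrite mulr_suml; apply: ler_sum => l _.
    have -> : (i + j = (k + l) + ((i - k) + (j - l)))%N.
      have ki := ltn_ord k; have lj := ltn_ord l.
      by rewrite addnACA !subnKC.
    rewrite exprD mulrACA.
    by apply: ler_pM => //; rewrite mulr_ge0 // exprn_ge0 // ltW.
  apply: le_trans bnd _.
  rewrite !sumr_const !card_ord -!mulrnA -[X in X <= _]mulr_natr.
  apply: ler_wpM2l.
    by rewrite mulr_ge0 //; apply: le_trans (hN 0%N 0%N); rewrite mulr_ge0 // exprn_ge0 // ltW.
  by rewrite -natrX ler_nat expnD mulnC leq_mul // ltn_expl.
Qed.

HB.instance Definition _ :=
  GRing.isSubalgClosed.Build K (fps2 K) convergent convergent_subalg.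

(* The ring K{x, y} of convergent power series; for K = R[i], the ring of germs
   of holomorphic functions at the origin of the affine plane. *)
Record germ := Germ {germ_val : fps2 K; germ_valP : germ_val \in convergent}.

HB.instance Definition _ := [isSub of germ for germ_val].
HB.instance Definition _ := [Choice of germ by <:].
HB.instance Definition _ := [SubChoice_isSubComNzRing of germ by <:].
HB.instance Definition _ := [SubZmodule_isSubLmodule of germ by <:].
HB.instance Definition _ := [SubNzRing_SubLmodule_isSubLalgebra of germ by <:].
HB.instance Definition _ := GRing.Lalgebra_isComAlgebra.Build K germ.

Lemma convergent_monomial m n :
  ((fun i j => ((i == m) && (j == n))%:R) : fps2 K) \in convergent.
Proof.
apply/asboolP; exists 1 => //; exists 1 => i j; rewrite expr1n mulr1.
by case: (_ && _); rewrite ?normr1 ?normr0.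
Qed.

Definition germX : germ := Germ (convergent_monomial 1%N 0%N).
Definition germY : germ := Germ (convergent_monomial 0%N 1%N).

End ConvergentPowerSeries.

Section PlaneCurveGerms.
Variable K : numFieldType.
Implicit Types a b f g h u : germ K.

(* [f] divides [g]; that is, g = 0 in the local ring K{x, y}/(f). *)
Definition germ_dvd f g := exists h, g = f * h.

Definition germ_unit g := exists h, g * h = 1.

Definition irreducible_germ g :=
  [/\ g <> 0, ~ germ_unit g &
      forall a b, g = a * b -> germ_unit a \/ germ_unit b].

(* The branches of the curve germ f = 0 are the germs g = 0, for g in [s].
   K{x, y} being factorial, they are unique up to units and order. *)
Definition branch_decomposition f (s : seq (germ K)) :=
  (forall g, g \in s -> irreducible_germ g) /\
  (exists2 u, germ_unit u & f = u * \prod_(g <- s) g).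

Definition branches f : seq (germ K) :=
  xget [::] (branch_decomposition f).

(* [g] has order n: its homogeneous part of least degree has degree n. *)
Definition has_order g n :=
  (exists i j, (i + j = n)%N /\ val g i j <> 0) /\
  (forall i j, (i + j < n)%N -> val g i j = 0).

(* The multiplicity at the origin of the germ g = 0, for g <> 0. *)
Definition mult g : nat := xget 0%N (has_order g).

(* Two plane curve germs are analytically isomorphic when their equations agree
   up to a unit and a change of the local analytic coordinates, i.e. an
   automorphism of the K-algebra K{x, y}. *)
Definition analytically_equivalent f g :=
  exists (phi : {lrmorphism germ K -> germ K}) u,
    [/\ bijective phi, germ_unit u & f = u * phi g].

Definition ordinary_cusp f :=
  analytically_equivalent f (germX K ^+ 2 - germY K ^+ 3).

Definition ordinary_node f :=
  analytically_equivalent f (germX K * germY K).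

(* Below, O is the local ring K{x, y}/(f), and the elements of its total ring of
   fractions are written a / b, where the class of b in O is not a zero
   divisor. *)
Definition nonzerodivisor f b := forall g, germ_dvd f (b * g) -> germ_dvd f g.

(* The fraction a / b is integral over O: it is annihilated by the monic
   polynomial z^n + \sum_(k < n) c_k z^k (an equation from which the denominator
   b^n has been cleared). *)
Definition integral_fraction f a b :=
  exists n (c : 'I_n -> germ K),
    germ_dvd f (a ^+ n + \sum_(k < n) c k * a ^+ k * b ^+ (n - k)).

(* The normalization N of O (its integral closure in its total ring of
   fractions) contains n elements which are linearly independent modulo O; they
   are written a_k / b over a common denominator. *)
Definition independent_in_normalization f n :=
  exists b (a : 'I_n -> germ K),
    [/\ nonzerodivisor f b, forall k, integral_fraction f (a k) b &
        forall t : 'I_n -> K,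
          (exists g, germ_dvd f (\sum_(k < n) t k *: a k - g * b)) ->
          forall k, t k = 0].

Definition virtual_cusps_at f : int :=
  \sum_(g <- branches f) ((mult g)%:Z - 1).

End PlaneCurveGerms.

Section Delta.
Variable R : realType.
Local Open Scope classical_set_scope.
Local Open Scope ereal_scope.

(* The dimension of N / O over R[i]; it is an extended real because it is defined
   for any f, although it is a natural number whenever f is reduced. *)
Definition delta (f : germ R[i]) : \bar R :=
  ereal_sup [set n%:R%:E | n in [set n : nat | independent_in_normalization f n]].

Definition virtual_nodes_at (f : germ R[i]) : \bar R :=
  delta f - (virtual_cusps_at f)%:~R%:E.

End Delta.

Section ProjectivePlane.
Variable K : numFieldType.

(* Points of P^2 are represented by their unique homogeneous coordinates whose
   first nonzero entry is 1. *)
Definition normalized (p : 'rV[K]_3) :=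
  [exists i, (p 0 i == 1) && [forall j : 'I_3, (j < i)%N ==> (p 0 j == 0)]].

Definition P2 := {p : 'rV[K]_3 | normalized p}.

Definition homcoord (p : P2) (i : 'I_3) : K := val p 0 i.

(* The index of an affine chart x_i = 1 containing p. *)
Definition chart (p : P2) : 'I_3 := odflt ord0 [pick i | homcoord p i == 1].

(* The local equation at p of the curve F = 0: the power series in (x, y)
   obtained by dehomogenizing F in the chart and moving p to the origin. *)
Definition local_shift (p : P2) (i : 'I_3) : germ K :=
  if unlift (chart p) i is Some k then
    if k == ord0 :> 'I_2 then germX K else germY K
  else 0.

Definition local_equation (F : {mpoly K[3]}) (p : P2) : germ K :=
  mmap (in_alg (germ K)) (fun i => (homcoord p i)%:A + local_shift p i) F.

(* The plane curve F = 0 is reduced: F is squarefree. *)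
Definition reduced_curve (F : {mpoly K[3]}) :=
  [/\ F != 0, exists2 d, (0 < d)%N & F \is d.-homog &
      forall G H : {mpoly K[3]}, F = G ^+ 2 * H -> (msize G <= 1)%N].

Definition Sing (F : {mpoly K[3]}) : set P2 :=
  [set p | F.@[homcoord p] = 0 /\ forall i, (F^`M(i)).@[homcoord p] = 0]%classic.

Definition cusps (F : {mpoly K[3]}) : set P2 :=
  [set p | Sing F p /\ ordinary_cusp (local_equation F p)]%classic.

Definition nodes (F : {mpoly K[3]}) : set P2 :=
  [set p | Sing F p /\ ordinary_node (local_equation F p)]%classic.

Definition cuspidal (F : {mpoly K[3]}) :=
  forall p, Sing F p -> cusps F p \/ nodes F p.

(* [fset_set] and the sums over [Sing F] are meant for finite sets; the singular
   locus of a reduced curve is finite. *)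
Definition num_cusps (F : {mpoly K[3]}) : nat := #|` fset_set (cusps F)|%fset.
Definition num_nodes (F : {mpoly K[3]}) : nat := #|` fset_set (nodes F)|%fset.

Definition virtual_cusps (F : {mpoly K[3]}) : int :=
  \sum_(p \in Sing F) virtual_cusps_at (local_equation F p).

End ProjectivePlane.

Definition virtual_nodes (R : realType) (F : {mpoly R[i][3]}) : \bar R :=
  (\sum_(p \in Sing F) virtual_nodes_at (local_equation F p))%E.

(* Main.v *)
(* Everything is local at the singular points. Let f be a germ of order m with
   branches of multiplicities m_i; orders are additive, so m = sum m_i and the
   number of virtual cusps is m minus the number of branches. If u = 0 is a line
   transversal to the tangent cone of f = 0, then y / u is integral over O, and
   y / u, y^2 / u, .., y^(m-1) / u are linearly independent modulo O; hence
   delta >= m - 1 >= sum (m_i - 1).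

   An ordinary cusp is irreducible of order 2, and an ordinary node has two
   branches of order 1. In both cases delta >= 1 by the above. Conversely, the
   pullback to a parametrization of the branches (t^3, t^2), resp. (t, 0) and
   (0, t), sends integral fractions to convergent power series, and such a tuple
   of series comes from O as soon as one linear functional vanishes on it: the
   coefficient of t, resp. the difference of the two constant terms. *)
From HB Require Import structures.
Require Import Defs.
From mathcomp Require Import all_boot all_order all_algebra.
From mathcomp Require Import complex mpoly finmap ring zify.
From mathcomp Require Import boolp classical_sets functions cardinality fsbigop.
From mathcomp Require Import reals ereal.
Local Open Scope ring_scope.

Set Implicit Arguments.
Unset Strict Implicit.
Unset Printing Implicit Defensive.

Import Order.TTheory GRing.Theory Num.Theory.

(** * Power series and their restrictions to parametrized curves *)

Section Series.
Variable K : comNzRingType.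
Implicit Types (a b : fps2 K) (m n : nat).

Lemma fps2_addE a b i j : (a + b) i j = a i j + b i j.
Proof. by []. Qed.

Lemma fps2_oppE a i j : (- a) i j = - a i j.
Proof. by []. Qed.

Lemma fps2_subE a b i j : (a - b) i j = a i j - b i j.
Proof. by []. Qed.

Lemma fps2_1E i j : (1 : fps2 K) i j = ((i == 0%N) && (j == 0%N))%:R.
Proof. by []. Qed.

Lemma fps2_scaleE t a i j : (t *: a) i j = t * a i j.
Proof. by []. Qed.

Lemma fps2_mul_coef a b i j :
  (a * b) i j = \sum_(k < i.+1) \sum_(l < j.+1) a k l * b (i - k)%N (j - l)%N.
Proof. by []. Qed.

Lemma fps2_sumE (I : Type) (r : seq I) (P : pred I) (F : I -> fps2 K) i j :
  (\sum_(k <- r | P k) F k) i j = \sum_(k <- r | P k) F k i j.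
Proof. by elim/big_rec2: _ => // k x y _ <-. Qed.

Definition monomial m n : fps2 K := fun i j => ((i == m) && (j == n))%:R.

Lemma monomial_mulE m n a i j :
  (monomial m n * a) i j =
  if (m <= i)%N && (n <= j)%N then a (i - m)%N (j - n)%N else 0.
Proof.
rewrite fps2_mul_coef; case: ifPn => [/andP[mi nj]|].
  rewrite -ltnS in mi; rewrite -ltnS in nj.
  rewrite (bigD1 (Ordinal mi)) //= (bigD1 (Ordinal nj)) //= /monomial !eqxx mul1r.
  rewrite !big1 ?addr0 // => [k km|l lm].
    by apply: big1 => l _; rewrite -val_eqE /= in km; rewrite (negPf km) mul0r.
  by rewrite -val_eqE /= in lm; rewrite (negPf lm) andbF mul0r.
move=> h; apply: big1 => k _; apply: big1 => l _; rewrite /monomial.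
case: eqP => [km|]; last by rewrite mul0r.
case: eqP => [lm|]; last by rewrite mul0r.
by case/negP: h; rewrite -km -lm !leq_ord.
Qed.

Lemma monomialM m n m' n' :
  monomial m n * monomial m' n' = monomial (m + m') (n + n').
Proof.
apply: fps2P => i j; rewrite monomial_mulE /monomial.
case: ifPn => [/andP[mi nj]|].
  by rewrite -(eqn_add2l m (i - m)) -(eqn_add2l n (j - n)) !subnKC.
move=> h; case: (i =P _) => [im|] //=; case: (j =P _) => [jn|] //=.
by rewrite im jn !leq_addr in h.
Qed.

Lemma monomialX m n k : monomial m n ^+ k = monomial (m * k) (n * k).
Proof.
elim: k => [|k IH]; first by rewrite !muln0 expr0; apply: fps2P => i j.
by rewrite exprS IH monomialM !mulnS.
Qed.

(** Membership in the $n$-th power of the maximal ideal $(x, y)$; unlike an exact order, it makes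
    sense for [0] too. *)
Definition vanishing n a := forall i j, (i + j < n)%N -> a i j = 0.

Lemma vanishing0 n : vanishing n 0.
Proof. by []. Qed.

Lemma vanishingW m n a : (m <= n)%N -> vanishing n a -> vanishing m a.
Proof. by move=> mn h i j ij; apply: h; apply: leq_trans mn. Qed.

Lemma vanishingD n a b : vanishing n a -> vanishing n b -> vanishing n (a + b).
Proof. by move=> ha hb i j ij; rewrite fps2_addE ha // hb // addr0. Qed.

Lemma vanishingN n a : vanishing n a -> vanishing n (- a).
Proof. by move=> ha i j ij; rewrite fps2_oppE ha // oppr0. Qed.

Lemma vanishing_sum n (I : Type) (r : seq I) (P : pred I) (F : I -> fps2 K) :
  (forall i, P i -> vanishing n (F i)) -> vanishing n (\sum_(i <- r | P i) F i).
Proof.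
move=> h; elim/big_rec: _ => [|i x Pi hx]; first exact: vanishing0.
by apply: vanishingD => //; exact: h.
Qed.

Lemma vanishingM m n a b :
  vanishing m a -> vanishing n b -> vanishing (m + n) (a * b).
Proof.
move=> ha hb i j ij; rewrite fps2_mul_coef; apply: big1 => k _.
apply: big1 => l _; have [klm|] := ltnP (k + l) m; first by rewrite ha ?mul0r.
move=> mkl; rewrite hb ?mulr0 //.
have := ltn_ord k; have := ltn_ord l; rewrite !ltnS => lj ki.
by rewrite -(ltn_add2l (k + l)) addnACA !subnKC // (leq_trans ij) // leq_add2r.
Qed.

Lemma vanishingMr n a b : vanishing n a -> vanishing n (a * b).
Proof. by move=> ha; rewrite -[n]addn0; exact: vanishingM. Qed.

Lemma vanishingMl n a b : vanishing n b -> vanishing n (a * b).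
Proof. by rewrite mulrC; exact: vanishingMr. Qed.

Lemma vanishingX m n a : vanishing m a -> vanishing (m * n) (a ^+ n).
Proof.
move=> ha; elim: n => [|n IH]; first by rewrite muln0.
by rewrite exprS mulnS; exact: vanishingM.
Qed.

Lemma vanishing_monomial m n : vanishing (m + n) (monomial m n).
Proof.
move=> i j; rewrite /monomial; case: eqP => // ->; case: eqP => // ->.
by rewrite ltnn.
Qed.

Lemma fps2_neq0_order a : a <> 0 ->
  exists n, vanishing n a /\ ~ vanishing n.+1 a.
Proof.
move=> a0; have : exists n, `[< exists i j, (i + j = n)%N /\ a i j <> 0 >].
  apply: contrapT => h; apply: a0; apply: fps2P => i j; apply: contrapT => aij.
  by apply: h; exists (i + j)%N; apply/asboolP; exists i, j.
move=> ex; case: (ex_minnP ex) => n /asboolP [i [j [ijn aij]]] nmin.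
exists n; split=> [k l kl|/(_ i j)]; last by rewrite ijn ltnSn => /(_ isT).
apply: contrapT => akl.
have /nmin : `[< exists i j, (i + j = k + l)%N /\ a i j <> 0 >].
  by apply/asboolP; exists k, l.
by rewrite leqNgt kl.
Qed.

End Series.

Section ParametrizedCurve.
Variables (K : comNzRingType) (al be : K) (p q : nat).
Implicit Types a b : fps2 K.

(* The restriction of a to the curve (x, y) = (al t^p, be t^q), p, q > 0, as a
   power series in t = y. *)
Definition pullback a : fps2 K := fun i n =>
  if i == 0%N then
    \sum_(k < n.+1) \sum_(l < n.+1)
      (n == p * k + q * l)%N%:R * (al ^+ k * be ^+ l) * a k l
  else 0.

Lemma pullbackB : zmod_morphism pullback.
Proof.
move=> a b; apply: fps2P => i n; rewrite fps2_subE /pullback.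
case: eqP => _; last by rewrite subr0.
rewrite -sumrB; apply: eq_bigr => k _; rewrite -sumrB; apply: eq_bigr => l _.
by rewrite fps2_subE mulrBr.
Qed.

Lemma pullbackZ : scalable pullback.
Proof.
move=> t a; apply: fps2P => i n; rewrite fps2_scaleE /pullback.
case: eqP => _; last by rewrite mulr0.
rewrite mulr_sumr; apply: eq_bigr => k _; rewrite mulr_sumr.
by apply: eq_bigr => l _; rewrite fps2_scaleE mulrCA.
Qed.

Hypotheses (p_gt0 : (0 < p)%N) (q_gt0 : (0 < q)%N).

(** Substitution into polynomials, where it is a ring morphism by construction. Since [p] and [q]
    are positive, the coefficient of $t^n$ involves only exponents at most [n], so multiplicativity
    passes to series by truncation. *)
Let eval (P : {poly {poly K}}) : {poly K} :=
  (map_poly (comp_poly (be *: 'X^q)) P).[al *: 'X^p].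

Let coef_eval P n :
  (eval P)`_n = \sum_(k < n.+1) \sum_(l < n.+1)
      (n == p * k + q * l)%N%:R * (al ^+ k * be ^+ l) * P`_k`_l.
Proof.
(* [N] dominates [n.+1], the size of [P] and the sizes of its coefficients, so both sides become
   sums over one square; the added terms have $pk+ql>n$ or a zero coefficient. *)
pose N := (n.+1 + size P + \max_(k < size P) size (P`_k)%R)%N.
have nN : (n.+1 <= N)%N by rewrite /N -addnA leq_addr.
have sP : (size P <= N)%N by rewrite /N addnAC leq_addl.
have sPk k : (size (P`_k)%R <= N)%N.
  have [kP|kP] := ltnP k (size P); last by rewrite nth_default ?size_poly0.
  apply: leq_trans (leq_addl _ _).
  exact: (leq_bigmax (F := fun k : 'I_(size P) => size (P`_k)%R) (Ordinal kP)).
pose G k l := (n == p * k + q * l)%N%:R * (al ^+ k * be ^+ l) * P`_k`_l.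
have -> : (eval P)`_n = \sum_(k < N) \sum_(l < N) G k l.
  rewrite /eval (horner_coef_wide _ (n := N)); last first.
    by apply: leq_trans sP; exact: size_poly.
  rewrite coef_sum; apply: eq_bigr => k _; rewrite coef_map_id0 ?comp_poly0 //.
  rewrite comp_polyE exprZn -exprM -scalerAr coefZ mulr_suml.
  rewrite (big_ord_widen _ (fun l => P`_k`_l *: (be *: 'X^q) ^+ l * 'X^(p * k)) (sPk k)).
  rewrite big_mkcond coef_sum mulr_sumr; apply: eq_bigr => l _.
  rewrite /G; case: ltnP => lP; last by rewrite coef0 [P`_k`_l]nth_default // !mulr0.
  rewrite exprZn -exprM scalerA -scalerAl -exprD coefZ coefXn addnC.
  by move: (_ == _)%N%:R (P`_k`_l) => e c; ring.
rewrite [RHS](big_ord_widen N (fun k => \sum_(l < n.+1) G k l)) //.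
rewrite [RHS]big_mkcond; apply: eq_bigr => k _; case: ltnP => kn.
  rewrite [RHS](big_ord_widen N (fun l => G k l)) // [RHS]big_mkcond.
  apply: eq_bigr => l _; case: ltnP => // ln; rewrite /G ltn_eqF ?mul0r //.
  by apply: (leq_trans ln); apply: leq_trans (leq_addl _ _); exact: leq_pmull.
apply: big1 => l _; rewrite /G ltn_eqF ?mul0r //.
by apply: (leq_trans kn); apply: leq_trans (leq_addr _ _); exact: leq_pmull.
Qed.

Let eval_is_mult P Q : eval (P * Q) = eval P * eval Q.
Proof. by rewrite /eval rmorphM hornerM. Qed.

Let pullback_eval a n (P : {poly {poly K}}) :
    (forall k l, (k <= n)%N -> (l <= n)%N -> P`_k`_l = a k l) ->
  (eval P)`_n = pullback a 0 n.
Proof.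
move=> h; rewrite coef_eval /pullback; apply: eq_bigr => k _.
by apply: eq_bigr => l _; rewrite h ?leq_ord.
Qed.

Lemma pullbackM : {morph pullback : a b / a * b}.
Proof.
move=> a b; apply: fps2P => i n; case: i => [|i]; last first.
  rewrite fps2_mul_coef [LHS]/pullback /= big1 // => k _; apply: big1 => l _.
  case: k => [[|k] kP] /=; last by rewrite mul0r.
  by rewrite [X in _ * X]/pullback subn0 /= mulr0.
rewrite fps2_mul_coef big_ord1.
pose t := @fps2_trunc K n.+1; have tE := @coef_fps2_trunc K n.+1.
rewrite -(@pullback_eval _ _ (t a * t b)); last first.
  by move=> k l kn ln; apply: (@fps2_mulE K n.+1) => // k' l' ? ?; exact: tE.
rewrite eval_is_mult coefM; apply: eq_bigr => k _.
have := ltn_ord k; rewrite ltnS => kn.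
rewrite (@pullback_eval a); last first.
  by move=> k' l' h1 h2; apply: tE; rewrite ltnS (leq_trans _ kn).
rewrite (@pullback_eval b) // => k' l' h1 h2.
by apply: tE; rewrite ltnS (leq_trans _ (leq_subr k n)).
Qed.

Lemma pullback1 : pullback 1 = 1.
Proof.
apply: fps2P => [[|i]] n //; rewrite /pullback /= big_ord_recl /=.
rewrite [X in _ + X]big1 ?addr0 => [|k _]; last first.
  by apply: big1 => l _; rewrite fps2_1E /= mulr0.
rewrite big_ord_recl [X in _ + X]big1 ?addr0 => [|k _]; last first.
  by rewrite fps2_1E /= mulr0.
by rewrite !fps2_1E /= !muln0 addn0 !expr0 !mulr1.
Qed.

Lemma pullback_monomial k l :
  pullback (monomial K k l) =
  al ^+ k * be ^+ l *: monomial K 0 (p * k + q * l).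
Proof.
apply: fps2P => [[|i]] n; rewrite fps2_scaleE /pullback /=; last first.
  by rewrite /monomial mulr0.
rewrite /monomial /=.
have [->|nkl] := eqVneq n (p * k + q * l)%N; last first.
  rewrite mulr0; apply: big1 => k' _; apply: big1 => l' _.
  case: (nat_of_ord k' =P k) => [->|_]; last by rewrite andFb mulr0.
  case: (nat_of_ord l' =P l) => [->|_]; last by rewrite mulr0.
  by rewrite (negPf nkl) !mul0r.
have kn : (k < (p * k + q * l).+1)%N.
  by rewrite ltnS; apply: leq_trans (leq_addr _ _); exact: leq_pmull.
have ln : (l < (p * k + q * l).+1)%N.
  by rewrite ltnS; apply: leq_trans (leq_addl _ _); exact: leq_pmull.
rewrite (bigD1 (Ordinal kn)) //= (bigD1 (Ordinal ln)) //= !eqxx !mulr1 mul1r.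
rewrite !big1 ?addr0 // => [k' k'k|l' l'l].
  by apply: big1 => l' _; rewrite -val_eqE /= in k'k; rewrite (negPf k'k) mulr0.
by rewrite -val_eqE /= in l'l; rewrite (negPf l'l) mulr0.
Qed.

End ParametrizedCurve.

HB.instance Definition _ (K : comNzRingType) (al be : K) p q :=
  GRing.isZmodMorphism.Build (fps2 K) (fps2 K) (pullback al be p q)
    (pullbackB al be p q).
HB.instance Definition _ (K : comNzRingType) (al be : K) p q :=
  GRing.isScalable.Build K (fps2 K) (fps2 K) *:%R (pullback al be p q)
    (pullbackZ al be p q).
(** Multiplicativity relies on positive exponents; writing them as successors builds this into the
    instance. *)
HB.instance Definition _ (K : comNzRingType) (al be : K) p q :=
  GRing.isMonoidMorphism.Build (fps2 K) (fps2 K) (pullback al be p.+1 q.+1)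
    (pullback1 al be p.+1 q.+1, pullbackM al be (ltn0Sn p) (ltn0Sn q)).

Lemma pullbackD (K : comNzRingType) (al be : K) p q :
  {morph pullback al be p q : a b / a + b}.
Proof. exact: raddfD. Qed.

(** * Convergence *)

Section Convergence.
Variable K : numFieldType.
Implicit Types (a b : fps2 K) (C : K) (m n : nat).

(** The bound and the inverse radius are merged into one constant; the factor [k] lets later
    estimates multiply exponents and keep the same [C]. *)
Lemma geometric_convergent C k a : 1 <= C ->
  (forall i j, `|a i j| <= C ^+ (k * (i + j).+1)) -> a \in @convergent K.
Proof.
move=> C1 h; have C0 : 0 < C ^+ k by rewrite exprn_gt0 // (lt_le_trans ltr01).
apply/asboolP; exists (C ^+ k)^-1; first by rewrite invr_gt0.
exists (C ^+ k) => i j; rewrite exprVn ler_pdivrMr ?(exprn_gt0 _ C0) //.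
by apply: le_trans (h i j) _; rewrite exprM exprS.
Qed.

(** The sum [1 + M + r^-1] dominates both the bound [M], which takes one factor, and the inverse
    radius, which takes [i + j] factors. *)
Lemma convergent_geometric a : a \in @convergent K ->
  exists2 C : K, 1 <= C & forall i j, `|a i j| <= C ^+ (i + j).+1.
Proof.
move=> /asboolP [r r0 [M hM]].
have M0 : 0 <= M by apply: le_trans (hM 0%N 0%N); rewrite mulr_ge0 // exprn_ge0 // ltW.
have rV : 0 <= r^-1 by rewrite invr_ge0 ltW.
exists (1 + M + r^-1); first by rewrite -addrA lerDl addr_ge0.
move=> i j; have /(_ i j) := hM; rewrite -ler_pdivlMr ?exprn_gt0 // => /le_trans; apply.
rewrite exprS -exprVn; apply: ler_pM => //; first by rewrite exprn_ge0.
  by rewrite addrAC lerDr addr_ge0.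
by apply: lerXn2r; rewrite ?nnegrE ?addr_ge0 // lerDr addr_ge0.
Qed.

(** A linearly growing change of indices only multiplies the exponent of the geometric bound. *)
Lemma convergent_shift a (f g : nat -> nat -> nat) k :
  (forall i j, ((f i j + g i j).+1 <= k * (i + j).+1)%N) ->
  a \in @convergent K -> (fun i j => a (f i j) (g i j)) \in @convergent K.
Proof.
move=> hk /convergent_geometric [C C1 hC]; apply: (@geometric_convergent C k) => // i j.
by apply: le_trans (hC _ _) _; apply: ler_weXn2l.
Qed.

Lemma convergent_restrict a (P : nat -> nat -> bool) :
  a \in @convergent K -> (fun i j => if P i j then a i j else 0) \in @convergent K.
Proof.
move=> /convergent_geometric [C C1 hC]; apply: (@geometric_convergent C 1) => // i j.
rewrite mul1n; case: ifP => // _; rewrite normr0 exprn_ge0 //.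
exact: le_trans ler01 C1.
Qed.

Lemma ler_sum_const n (F : 'I_n -> K) (B : K) :
  (forall k, F k <= B) -> \sum_(k < n) F k <= n%:R * B.
Proof.
move=> h; apply: le_trans (ler_sum _ _) _; first by move=> k _; exact: h.
by rewrite sumr_const card_ord mulr_natl.
Qed.

Lemma natr_le_exp2 n : n%:R <= 2 ^+ n :> K.
Proof. by rewrite -natrX ler_nat ltnW // ltn_expl. Qed.

(** The coefficient of $t^n$ is a sum of $(n+1)^2\le 4^{n+1}$ terms, each at most $(DC)^{2(n+1)}$ in
    absolute value. *)
Lemma pullback_convergent al be p q a : (0 < p)%N -> (0 < q)%N ->
  a \in @convergent K -> pullback al be p q a \in @convergent K.
Proof.
move=> p0 q0 /convergent_geometric [C C1 hC].
pose D : K := 1 + `|al| + `|be|.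
have alD : `|al| <= D by rewrite /D addrAC lerDr addr_ge0.
have beD : `|be| <= D by rewrite lerDr addr_ge0.
have D1 : 1 <= D by rewrite /D -addrA lerDl addr_ge0.
have D0 : 0 <= D := le_trans ler01 D1.
have C0 : 0 <= C := le_trans ler01 C1.
have E1 : 1 <= 2 * D * C.
  by rewrite !mulr_ege1 // ler1n.
apply: (@geometric_convergent (2 * D * C) 2) => // i n; rewrite /pullback.
case: eqP => [->|_]; last by rewrite normr0 exprn_ge0 // (le_trans ler01).
have bnd (k l : 'I_n.+1) :
    `|(n == p * k + q * l)%N%:R * (al ^+ k * be ^+ l) * a k l| <=
    D ^+ (2 * n.+1) * C ^+ (2 * n.+1).
  rewrite !normrM !normrX; apply: ler_pM => //.
  - rewrite -[X in _ <= X]mul1r; apply: ler_pM => //.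
    + by case: eqP => _; rewrite ?normr1 ?normr0.
    + rewrite mul2n -addnn exprD; apply: ler_pM; rewrite ?exprn_ge0 //.
        apply: (@le_trans _ _ (D ^+ k)); first by apply: lerXn2r; rewrite ?nnegrE.
        by apply: ler_weXn2l => //; exact: ltnW.
      apply: (@le_trans _ _ (D ^+ l)); first by apply: lerXn2r; rewrite ?nnegrE.
      by apply: ler_weXn2l => //; exact: ltnW.
  - apply: le_trans (hC _ _) _; apply: ler_weXn2l => //.
    by rewrite mul2n -addnn -addnS leq_add // ltnW.
apply: le_trans (ler_norm_sum _ _ _) _.
apply: (@le_trans _ _ (n.+1%:R * (n.+1%:R * (D ^+ (2 * n.+1) * C ^+ (2 * n.+1))))).
  apply: ler_sum_const => k; apply: le_trans (ler_norm_sum _ _ _) _.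
  exact: ler_sum_const.
rewrite add0n !exprMn mulrA -[X in _ <= X]mulrA; apply: ler_pM => //.
- by rewrite mulr_ge0 ?exprn_ge0.
- by rewrite mul2n -addnn exprD; apply: ler_pM => //; exact: natr_le_exp2.
Qed.

(** [v] is the geometric series of [a]. As $a^k$ vanishes to order $k$, each coefficient is reached
    by a finite partial sum. *)
Lemma fps2_inv_exists a : a 0%N 0%N = 0 -> exists v : fps2 K, v = 1 + a * v.
Proof.
move=> a0; have a1 : vanishing 1 a by case=> // -[].
pose S n := \sum_(k < n) a ^+ k.
have stable n i j : (i + j < n)%N -> S n i j = S (i + j).+1 i j.
  move=> ijn; rewrite /S -(subnKC ijn) big_split_ord /= fps2_addE.
  rewrite -[RHS]addr0; congr (_ + _); rewrite fps2_sumE; apply: big1 => k _.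
  by apply: (vanishingX (m := 1)) => //; rewrite mul1n ltnS leq_addr.
have SE n : S n.+1 = 1 + a * S n.
  rewrite /S big_ord_recl expr0 mulr_sumr; congr (_ + _).
  by apply: eq_bigr => k _; rewrite -exprS.
exists (fun i j => S (i + j).+1 i j); apply: fps2P => i j; rewrite SE.
rewrite !fps2_addE; congr (_ + _); rewrite !fps2_mul_coef.
apply: eq_bigr => k _; apply: eq_bigr => l _.
(* The term [k = l = 0] is killed by [a0]; in the others the second factor has degree below [i + j],
   where [S (i + j)] is already stable. *)
case: k => [[|k] ki]; last first.
  by congr (_ * _); apply: stable => /=; have := leq_ord l; lia.
case: l => [[|l] lj]; first by rewrite /= a0 !mul0r.
by congr (_ * _); apply: stable => /=; lia.
Qed.

Lemma sum_half n : \sum_(k < n) 2^-1 ^+ k <= 2 :> K.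
Proof.
have -> : \sum_(k < n) 2^-1 ^+ k = 2 - 2 * 2^-1 ^+ n :> K.
  elim: n => [|n IH]; first by rewrite big_ord0 expr0 mulr1 subrr.
  by rewrite big_ord_recr /= IH exprS; field.
by rewrite gerBl mulr_ge0 ?exprn_ge0 ?invr_ge0 ?ler0n.
Qed.

(** Induction on the total degree in $v_{ij}=\sum a_{kl}v_{i-k,j-l}$: as [a] has no constant term,
    only coefficients of [v] of lower degree occur on the right. *)
Lemma convergent_inv a v : a 0%N 0%N = 0 -> v = 1 + a * v ->
  a \in @convergent K -> v \in @convergent K.
Proof.
move=> a0 vE /convergent_geometric [C C1 hC].
have C0 : 0 < C by apply: lt_le_trans C1.
(* With E = 8 C^2 the terms of the recursion for v are dominated by a geometric
   series of sum 1. *)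
pose E : K := 8 * C ^+ 2.
have E1 : 1 <= E by rewrite mulr_ege1 ?exprn_ege1 // ler1n.
have E0 : 0 < E by apply: lt_le_trans E1.
(* For $k+l>0$ one has $k+l+1\le 2(k+l)$, whence the square of [C] in [E]; the factor 8 pays for the
   4 and the powers of 2. *)
have ha k l : (0 < k + l)%N -> `|a k l| <= E ^+ (k + l) * (4^-1 * 2^-1 ^+ (k + l)).
  move=> kl; apply: le_trans (hC _ _) _; case: (k + l)%N kl => // n _.
  have -> : E ^+ n.+1 * (4^-1 * 2^-1 ^+ n.+1) = 4 ^+ n * (C ^+ 2) ^+ n.+1 :> K.
    rewrite /E exprMn mulrAC mulrCA -mulrA -exprMn mulrA; congr (_ * _).
    have -> : 8 * 2^-1 = 4 :> K by field.
    by rewrite exprS mulrA mulVf ?mul1r // pnatr_eq0.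
  rewrite -[X in X <= _]mul1r; apply: ler_pM; rewrite ?exprn_ge0 ?(ltW C0) //.
    by apply: exprn_ege1; rewrite ler1n.
  by rewrite -exprM; apply: ler_weXn2l => //; lia.
have hv n i j : (i + j < n)%N -> `|v i j| <= E ^+ (i + j).
  elim: n i j => // n IH i j; rewrite ltnS => ijn.
  case: (posnP (i + j)) => [/eqP|ij0].
    rewrite addn_eq0 => /andP [/eqP -> /eqP ->].
    rewrite vE fps2_addE fps2_mul_coef !big_ord1 a0 mul0r addr0 fps2_1E /=.
    by rewrite normr1 expr0.
  have -> : v i j = (a * v) i j.
    rewrite {1}vE fps2_addE fps2_1E -addn_eq0; first by rewrite eqn0Ngt ij0 add0r.
  rewrite fps2_mul_coef; apply: le_trans (ler_norm_sum _ _ _) _.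
  have term (k : 'I_i.+1) (l : 'I_j.+1) :
      `|a k l * v (i - k)%N (j - l)%N| <= E ^+ (i + j) * 4^-1 * 2^-1 ^+ k * 2^-1 ^+ l.
    have [kl0|kl0] := posnP (k + l).
      move/eqP: kl0; rewrite addn_eq0 => /andP [/eqP -> /eqP ->].
      by rewrite a0 mul0r normr0 !mulr_ge0 ?exprn_ge0 ?invr_ge0 ?ler0n // ltW.
    have ijkl : (i + j = (k + l) + (i - k + (j - l)))%N.
      by rewrite addnACA !subnKC // leq_ord.
    rewrite normrM.
    have -> : E ^+ (i + j) * 4^-1 * 2^-1 ^+ k * 2^-1 ^+ l =
      E ^+ (k + l) * (4^-1 * 2^-1 ^+ (k + l)) * E ^+ (i - k + (j - l)).
      by rewrite ijkl !exprD; ring.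
    apply: ler_pM => //; first exact: ha.
    apply: IH; apply: leq_trans ijn; rewrite ijkl.
    by rewrite -[X in (X < _)%N]add0n ltn_add2r.
  apply: (@le_trans _ _ (\sum_(k < i.+1) \sum_(l < j.+1)
      (E ^+ (i + j) * 4^-1 * 2^-1 ^+ k * 2^-1 ^+ l))).
    apply: ler_sum => k _; apply: le_trans (ler_norm_sum _ _ _) _.
    by apply: ler_sum => l _; exact: term.
  under eq_bigr do rewrite -mulr_sumr.
  rewrite -mulr_suml -mulr_sumr -!mulrA -[X in _ <= X]mulr1.
  apply: ler_wpM2l; first by rewrite exprn_ge0 // ltW.
  have h2 n' : 0 <= \sum_(k < n') 2^-1 ^+ k :> K.
    by apply: sumr_ge0 => k _; rewrite exprn_ge0 // invr_ge0 ler0n.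
  have e4 : 4^-1 * (2 * 2) = 1 :> K by field.
  rewrite -[X in _ <= X]e4.
  by apply: ler_wpM2l; rewrite ?invr_ge0 ?ler0n //; apply: ler_pM => //; exact: sum_half.
apply: (@geometric_convergent E 1) => // i j; rewrite mul1n.
by apply: le_trans (hv _ _ _ (ltnSn _)) _; apply: ler_weXn2l.
Qed.

(** Replacing $x^d$ by $cy^e$ repeatedly, $x^{i+d(k+1)}y^{j-ek}$ contributes $c^k$ times its
    coefficient to the quotient at $x^iy^j$; as $e>0$, only $k\le j$ occur. The coefficients with
    $i<d$ are left to a remainder. *)
Lemma division_convergent (c : K) d e a : (0 < d)%N -> (0 < e)%N ->
  a \in @convergent K ->
  exists2 h, h \in @convergent K &
    forall i j, (d <= i)%N -> 
      ((monomial K d 0 - c *: monomial K 0 e) * h) i j = a i j.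
Proof.
move=> d0 e0 /convergent_geometric [C C1 hC].
pose t i j k := if (e * k <= j)%N then c ^+ k * a (i + d * k.+1)%N (j - e * k)%N else 0.
pose h : fps2 K := fun i j => \sum_(k < j.+1) t i j k.
exists h.
  pose D : K := 1 + `|c|.
  have D1 : 1 <= D by rewrite lerDl.
  have D0 : 0 <= D := le_trans ler01 D1.
  have C0 : 0 <= C := le_trans ler01 C1.
  have E1 : 1 <= 2 * D * C ^+ d.+2.
    by rewrite mulr_ege1 ?exprn_ege1 // mulr_ege1 // ler1n.
  apply: (@geometric_convergent (2 * D * C ^+ d.+2) 1) => // i j; rewrite mul1n.
  apply: (@le_trans _ _ (2 ^+ j.+1 * (D ^+ j * (C ^+ d.+2) ^+ (i + j).+1))).
    apply: le_trans (ler_norm_sum _ _ _) _.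
    apply: (@le_trans _ _ (j.+1%:R * (D ^+ j * (C ^+ d.+2) ^+ (i + j).+1))); last first.
      apply: ler_wpM2r; last exact: natr_le_exp2.
      by rewrite mulr_ge0 // !exprn_ge0.
    apply: ler_sum_const => k; rewrite /t; case: ifP => _; last first.
      by rewrite normr0 mulr_ge0 // !exprn_ge0.
    rewrite normrM normrX; apply: ler_pM => //.
      apply: (@le_trans _ _ (D ^+ k)).
        by apply: lerXn2r; rewrite ?nnegrE // lerDr.
      by apply: ler_weXn2l => //; exact: leq_ord.
    apply: le_trans (hC _ _) _; rewrite -exprM; apply: ler_weXn2l => //.
    by have := leq_ord k; nia.
  rewrite (exprMn _ (2 * D)) (exprMn _ 2) -mulrA.
  apply: ler_pM; rewrite ?exprn_ge0 ?ler0n //.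
    by rewrite mulr_ge0 ?exprn_ge0.
    by apply: ler_weXn2l; rewrite ?ler1n // ltnS leq_addl.
  apply: ler_wpM2r; first by rewrite !exprn_ge0.
  by apply: ler_weXn2l => //; rewrite leqW // leq_addl.
move=> i j di; rewrite mulrBl -scalerAl fps2_subE fps2_scaleE !monomial_mulE.
rewrite di leq0n subn0 /= subn0.
(* The term of index 0 of $h_{i-d,j}$ is $a_{ij}$; the term of index [k.+1] cancels against [c]
   times the term of index [k] of $h_{i,j-e}$. *)
rewrite {1}/h big_ord_recl /t muln0 leq0n expr0 mul1r subn0 muln1 subnK //.
rewrite -[RHS]addr0 -addrA; congr (_ + _); apply/eqP; rewrite subr_eq0; apply/eqP.
case: leqP => [ej|je]; last first.
  rewrite mulr0; apply: big1 => k _; rewrite lift0.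
  by rewrite leqNgt (leq_trans je) // mulnS leq_addr.
rewrite /h mulr_sumr (big_ord_widen j (fun k => c * t i (j - e)%N k)); last first.
  by rewrite ltn_subrL e0; apply: leq_trans ej.
rewrite [RHS]big_mkcond; apply: eq_bigr => k _; rewrite lift0.
have ek : (e * k.+1 <= j)%N = (e * k <= j - e)%N by rewrite mulnS leq_subRL.
rewrite ek /t ltnS; case: (leqP (e * k) (j - e)) => h1; last by rewrite mulr0 if_same.
rewrite (leq_trans _ h1) ?leq_pmull // exprS mulrA; congr (_ * a _ _).
  by rewrite mulnS addnA subnK.
by rewrite mulnS subnDA.
Qed.

End Convergence.

(** * Orders, units and division of germs *)

Section Order.
Variable K : numFieldType.
Implicit Types (a b : fps2 K) (c : K) (m n : nat).

Definition order_is n a := vanishing n a /\ ~ vanishing n.+1 a.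

Lemma order_is_uniq m n a : order_is m a -> order_is n a -> m = n.
Proof.
move=> [hm nm] [hn nn]; case: (ltngtP m n) => // h.
  by case: nm; exact: vanishingW hn.
by case: nn; exact: vanishingW hm.
Qed.

(** In characteristic zero the first [size P] natural numbers are distinct candidates, more than [P]
    has roots. *)
Lemma nonroot_exists (P : {poly K}) : P != 0 -> exists c, P.[c] != 0.
Proof.
move=> P0; apply: contrapT => h.
pose s := [seq i%:R : K | i <- iota 0 (size P)].
have : (size s < size P)%N.
  apply: max_poly_roots => //.
    apply/allP => _ /mapP[i _ ->]; apply: contrapT => Pi; apply: h.
    by exists i%:R; apply/negP.
  by rewrite map_inj_uniq ?iota_uniq // => i j /eqP; rewrite eqr_nat => /eqP.
by rewrite size_map size_iota ltnn.
Qed.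

(** The form of degree [n] of [a], dehomogenized by $y=1$. *)
Definition homogeneous_part n a : {poly K} := \poly_(k < n.+1) a k (n - k)%N.

Lemma pullback_line c a n :
  pullback c 1 1 1 a 0 n = (homogeneous_part n a).[c].
Proof.
rewrite /pullback /= horner_poly; apply: eq_bigr => k _.
have kn : (n - k < n.+1)%N by rewrite ltnS leq_subr.
rewrite (bigD1 (Ordinal kn)) //= !mul1n subnKC ?leq_ord // eqxx mul1r expr1n mulr1.
rewrite big1 ?addr0 => [|l]; first by rewrite mulrC.
rewrite -val_eqE /= mul1n => h; case: eqP => [E|]; last by rewrite !mul0r.
by case/eqP: h; lia.
Qed.

Lemma vanishing_pullback (al be : K) p q n a : (0 < p)%N -> (0 < q)%N ->
  vanishing n a -> vanishing n (pullback al be p q a).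
Proof.
move=> p0 q0 h [|i] j ij; rewrite /pullback //= big1 // => k _.
apply: big1 => l _; case: eqP => [E|]; last by rewrite !mul0r.
by rewrite h ?mulr0 //; nia.
Qed.

Lemma order_homogeneous_part n a : order_is n a -> homogeneous_part n a != 0.
Proof.
move=> [hn nn]; apply/eqP => h; apply: nn => i j; rewrite ltnS leq_eqVlt.
case/orP=> [/eqP ijn|]; last exact: hn.
have : (homogeneous_part n a)`_i = 0 by rewrite h coef0.
by rewrite coef_poly ltnS -ijn leq_addr addKn.
Qed.

Lemma mul_initial m n a b : vanishing m a -> vanishing n b ->
  (a * b) 0%N (m + n)%N = a 0%N m * b 0%N n.
Proof.
move=> ha hb; rewrite fps2_mul_coef big_ord1.
have mmn : (m < (m + n).+1)%N by rewrite ltnS leq_addr.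
rewrite (bigD1 (Ordinal mmn)) //= addKn big1 ?addr0 // => l.
rewrite -val_eqE /= neq_ltn => /orP [lm|ml].
  by rewrite ha ?mul0r.
by rewrite [X in _ * X]hb ?mulr0 //; have := leq_ord l; lia.
Qed.

(** The initial forms are nonzero, so some [c] is a root of neither. On the line $x=cy$ the
    coefficient of $t^{m+n}$ in the product is then a product of two nonzero numbers. *)
Lemma order_isM m n a b :
  order_is m a -> order_is n b -> order_is (m + n) (a * b).
Proof.
move=> oa ob; have [ha _] := oa; have [hb _] := ob.
split; first exact: vanishingM.
have : homogeneous_part m a * homogeneous_part n b != 0.
  by rewrite mulf_neq0 // order_homogeneous_part.
case/nonroot_exists => c; rewrite hornerM -!pullback_line => /eqP hc hab.
apply: hc; rewrite -mul_initial; do 2?exact: vanishing_pullback.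
by rewrite -pullbackM //; apply: (vanishing_pullback _ _ _ _ hab).
Qed.

Lemma fps2_mulI a b : a <> 0 -> a * b = 0 -> b = 0.
Proof.
move=> a0 ab; apply: contrapT => b0.
have [m ha] := fps2_neq0_order a0; have [n hb] := fps2_neq0_order b0.
by have [_] := order_isM ha hb; rewrite ab; apply; exact: vanishing0.
Qed.

Lemma order_vanishing n a b : order_is n a -> vanishing n.+1 b -> order_is n (a + b).
Proof.
move=> [ha na] hb; split; first by apply: vanishingD => //; exact: vanishingW hb.
move=> hab; apply: na; rewrite -(addrK b a); apply: vanishingD => //.
exact: vanishingN.
Qed.

Lemma order_isX m n a : order_is m a -> order_is (m * n) (a ^+ n).
Proof.
move=> ha; elim: n => [|n IH].
  rewrite muln0 expr0; split=> // /(_ 0%N 0%N isT) /eqP.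
  by rewrite fps2_1E /= oner_eq0.
by rewrite exprS mulnS; exact: order_isM.
Qed.

End Order.

(** * Germs: units, division, and the ideals of a line, the cusp and the node *)

Section Germs.
Variable K : numFieldType.
Implicit Types (f g h u : germ K) (c : K) (m n : nat).

Local Notation X := (germX K).
Local Notation Y := (germY K).

Lemma val_germM g h : val (g * h) = val g * val h. Proof. by []. Qed.
Lemma val_germD g h : val (g + h) = val g + val h. Proof. by []. Qed.
Lemma val_germB g h : val (g - h) = val g - val h. Proof. by []. Qed.
Lemma val_germZ c g : val (c *: g) = c *: val g. Proof. by []. Qed.
Lemma val_germ1 : val (1 : germ K) = 1. Proof. by []. Qed.
Lemma val_germX_exp g n : val (g ^+ n) = val g ^+ n.
Proof. by elim: n => // n IH; rewrite !exprS -IH. Qed.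

Lemma val_germX : val X = monomial K 1 0. Proof. by []. Qed.
Lemma val_germY : val Y = monomial K 0 1. Proof. by []. Qed.

Lemma val_XnYm m n : val (X ^+ m * Y ^+ n) = monomial K m n.
Proof.
rewrite val_germM !val_germX_exp !monomialX !monomialM.
by rewrite !mul1n !mul0n addn0.
Qed.

Lemma germ_mulI g h : g <> 0 -> g * h = 0 -> h = 0.
Proof.
move=> g0 gh; apply: val_inj; apply: (@fps2_mulI _ (val g)).
  by move=> E; apply: g0; exact: val_inj.
by rewrite -val_germM gh.
Qed.

(** Dividing [g] by its constant term gives $1-a$ with $a(0,0)=0$, which the convergent geometric
    series inverts. *)
Lemma germ_unitP g : germ_unit g <-> val g 0%N 0%N <> 0.
Proof.
split=> [[h gh] g0|/eqP g0].
  have /eqP : (val (g * h)) 0%N 0%N = 1 by rewrite gh.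
  by rewrite val_germM fps2_mul_coef !big_ord1 g0 mul0r eq_sym oner_eq0.
pose t := val g 0%N 0%N; pose a : germ K := 1 - t^-1 *: g.
have a0 : val a 0%N 0%N = 0.
  by rewrite val_germB val_germ1 fps2_subE val_germZ fps2_scaleE fps2_1E /= mulVf ?subrr.
have [v vE] := fps2_inv_exists a0.
have vc := convergent_inv a0 vE (valP a).
exists (t^-1 *: Germ vc); apply: val_inj; rewrite -scalerAr scalerAl val_germM.
have -> : t^-1 *: g = 1 - a by rewrite /a opprB addrC subrK.
by rewrite val_germB mulrBl mul1r /= {1}vE addrK.
Qed.

Lemma germ_nonunitP g : ~ germ_unit g <-> vanishing 1 (val g).
Proof.
split=> [ng [|i] [|j] //= _|h].
  by apply: contrapT => g0; apply: ng; apply/germ_unitP.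
by move/germ_unitP; apply; apply: h.
Qed.

Lemma germ_unit_order g : germ_unit g <-> order_is 0 (val g).
Proof.
split=> [ug|[_ ng]]; first by split=> // /germ_nonunitP; apply.
by apply: contrapT => /germ_nonunitP.
Qed.

Lemma germ_neq0_order g : g <> 0 -> exists n, order_is n (val g).
Proof.
by move=> g0; apply: fps2_neq0_order => E; apply: g0; exact: val_inj.
Qed.

Lemma germ_unitM g h : germ_unit (g * h) <-> germ_unit g /\ germ_unit h.
Proof.
rewrite !germ_unitP val_germM fps2_mul_coef !big_ord1.
split=> [gh|[/eqP g0 /eqP h0]]; last by apply/eqP; rewrite mulf_neq0.
by split=> E; apply: gh; rewrite E ?mul0r ?mulr0.
Qed.

Lemma monomial_dvd m n g :
  (forall i j, ~~ ((m <= i)%N && (n <= j)%N) -> val g i j = 0) ->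
  exists h, g = X ^+ m * Y ^+ n * h /\ forall i j, val h i j = val g (i + m)%N (j + n)%N.
Proof.
move=> hg.
have hc : (fun i j => val g (i + m)%N (j + n)%N) \in @convergent K.
  apply: (@convergent_shift _ _ _ _ (m + n).+1) (valP g) => i j; nia.
exists (Germ hc); split=> //; apply: val_inj; rewrite val_germM val_XnYm.
apply: fps2P => i j; rewrite monomial_mulE /=; case: ifPn => [/andP[mi nj]|].
  by rewrite !subnK.
exact: hg.
Qed.

(** Weierstrass division: the remainder is a polynomial in $x$ of degree less than [d] over the
    series in $y$. *)
Lemma germ_division c d e g : (0 < d)%N -> (0 < e)%N ->
  exists h r, g = (X ^+ d - c *: Y ^+ e) * h + r /\
    forall i j, (d <= i)%N -> val r i j = 0.
Proof.
move=> d0 e0; have [h hc hE] := division_convergent c d0 e0 (valP g).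
exists (Germ hc), (g - (X ^+ d - c *: Y ^+ e) * Germ hc).
split; first by rewrite addrC subrK.
move=> i j di; rewrite val_germB fps2_subE val_germM val_germB val_germZ.
have -> : val (X ^+ d) = monomial K d 0 by rewrite -val_XnYm expr0 mulr1.
have -> : val (Y ^+ e) = monomial K 0 e by rewrite -val_XnYm expr0 mul1r.
by rewrite hE // subrr.
Qed.

Lemma pullback_X (al be : K) p q n :
  pullback al be p.+1 q.+1 (val (X ^+ n)) = al ^+ n *: monomial K 0 (p.+1 * n).
Proof.
rewrite -[X ^+ n]mulr1 -(expr0 Y) val_XnYm pullback_monomial //.
by rewrite expr0 mulr1 muln0 addn0.
Qed.

Lemma pullback_Y (al be : K) p q n :
  pullback al be p.+1 q.+1 (val (Y ^+ n)) = be ^+ n *: monomial K 0 (q.+1 * n).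
Proof.
rewrite -[Y ^+ n]mul1r -(expr0 X) val_XnYm pullback_monomial //.
by rewrite expr0 mul1r muln0 add0n.
Qed.

(** The remainder modulo $x-cy$ is a series in $y$ alone, which the parametrization $(ct,t)$ leaves
    unchanged; so it is zero. *)
Lemma line_dvd c g : pullback c 1 1 1 (val g) = 0 -> germ_dvd (X - c *: Y) g.
Proof.
have [//|//|h [r [gE hr]]] := @germ_division c 1 1 g.
move=> g0; exists h; rewrite gE -[RHS]addr0; congr (_ + _).
have r0 : pullback c 1 1 1 (val r) = 0.
  have -> : r = g - (X ^+ 1 - c *: Y ^+ 1) * h by rewrite gE addrAC subrr add0r.
  rewrite val_germB pullbackB g0 val_germM pullbackM // val_germB pullbackB.
  rewrite val_germZ pullbackZ pullback_X pullback_Y expr1n expr1 scale1r.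
  by rewrite subrr mul0r subrr.
apply: val_inj; apply: fps2P => -[|i] j; last exact: hr.
have : pullback c 1 1 1 (val r) 0%N j = 0 by rewrite r0.
rewrite pullback_line /homogeneous_part horner_poly big_ord_recl /= subn0 expr0 mulr1.
rewrite big1 ?addr0 // => k _; rewrite hr ?mul0r //.
Qed.

(** For $k<2$ the parity of $3k+2l$ determines $k$, hence $l$, so no two monomials of [r] yield the
    same power of $t$. *)
Lemma pullback_cuspidal (r : fps2 K) k l :
  (forall i j, (2 <= i)%N -> r i j = 0) -> (k < 2)%N ->
  pullback 1 1 3 2 r 0%N (3 * k + 2 * l)%N = r k l.
Proof.
move=> hr k2; rewrite /pullback /=.
have kn : (k < (3 * k + 2 * l).+1)%N by lia.
have ln : (l < (3 * k + 2 * l).+1)%N by lia.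
rewrite (bigD1 (Ordinal kn)) //= (bigD1 (Ordinal ln)) //= eqxx !expr1n !mul1r.
rewrite big1 ?addr0; last first.
  move=> l'; rewrite -val_eqE /= => l'l; case: eqP => [E|]; last by rewrite !mul0r.
  by case/eqP: l'l; lia.
rewrite big1 ?addr0 // => k'; rewrite -val_eqE /= => k'k; apply: big1 => l' _.
have [k'2|k'2] := ltnP k' 2; last by rewrite hr ?mulr0.
case: eqP => [E|]; last by rewrite !mul0r.
by case/eqP: k'k; lia.
Qed.

(** The remainder has degree less than 2 in $x$, so all its coefficients can be read off its
    pullback, which is zero. *)
Lemma cusp_dvd g : pullback 1 1 3 2 (val g) = 0 -> germ_dvd (X ^+ 2 - Y ^+ 3) g.
Proof.
have [//|//|h [r [gE hr]]] := @germ_division 1 2 3 g.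
rewrite scale1r in gE.
move=> g0; exists h; rewrite gE -[RHS]addr0; congr (_ + _).
have r0 : pullback 1 1 3 2 (val r) = 0.
  have -> : r = g - (X ^+ 2 - Y ^+ 3) * h by rewrite gE addrAC subrr add0r.
  rewrite val_germB pullbackB g0 val_germM pullbackM // val_germB pullbackB.
  by rewrite pullback_X pullback_Y !expr1n subrr mul0r subrr.
apply: val_inj; apply: fps2P => i j.
have [i2|i2] := ltnP i 2; last exact: hr.
by rewrite -(pullback_cuspidal j hr i2) r0.
Qed.

Lemma pullback_xaxis (r : fps2 K) n : pullback 1 0 1 1 r 0%N n = r n 0%N.
Proof.
rewrite /pullback /= (bigD1 ord_max) //= (bigD1 ord0) //= big1 => [|l]; last first.
  by rewrite -val_eqE /= => l0; rewrite [0 ^+ l]expr0n (negPf l0) !mulr0 mul0r.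
rewrite big1 => [|k]; last first.
  rewrite -val_eqE /= => ki; apply: big1 => l _.
  case: eqP => [E|]; last by rewrite !mul0r.
  have l0 : (0 < l)%N by move/eqP: ki; lia.
  by rewrite expr0n gtn_eqF // !mulr0 mul0r.
by rewrite muln0 mul1n addn0 eqxx expr1n expr0 !mulr1 mul1r !addr0.
Qed.

Lemma pullback_yaxis (r : fps2 K) n : pullback 0 1 1 1 r 0%N n = r 0%N n.
Proof. by rewrite pullback_line horner_coef0 coef_poly subn0. Qed.

(** Vanishing on both axes removes the constant term and the pure powers of $x$ and $y$. *)
Lemma node_dvd g :
  pullback 1 0 1 1 (val g) = 0 -> pullback 0 1 1 1 (val g) = 0 ->
  germ_dvd (X * Y) g.
Proof.
move=> gx gy; have [|h [-> _]] := @monomial_dvd 1 1 g; last by exists h.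
move=> [|i] [|j] // _; first by rewrite -pullback_yaxis gy.
  by rewrite -pullback_yaxis gy.
by rewrite -pullback_xaxis gx.
Qed.

End Germs.

(** * The lower bound for the delta invariant *)

Section Normalization.
Variable K : numFieldType.
Implicit Types (f g h u : germ K) (c : K) (m n : nat).

Local Notation X := (germX K).
Local Notation Y := (germY K).
Local Notation line c := (X - c *: Y).

Lemma val_line c : val (line c) = monomial K 1 0 - c *: monomial K 0 1.
Proof. by []. Qed.

Lemma vanishing_line c : vanishing 1 (val (line c)).
Proof.
by move=> [|i] [|j] // _; rewrite val_line fps2_subE fps2_scaleE /monomial /= mulr0 subr0.
Qed.

Lemma pullback_line_eq0 c : pullback c 1 1 1 (val (line c)) = 0.
Proof.
rewrite val_germB pullbackB val_germZ pullbackZ -[X]expr1 -[Y]expr1.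
by rewrite pullback_X pullback_Y expr1n expr1 scale1r subrr.
Qed.

(** As [r] has no monomial divisible by $x$, the coefficient of $x^{i+1}y^j$ gives
    $h_{ij}=c\,h_{i+1,j-1}$ in low degree, and $h_{i0}=0$; hence an induction on [j]. *)
Lemma vanishing_line_quotient c n h r : (forall i j, (1 <= i)%N -> val r i j = 0) ->
  vanishing n.+1 (val (line c * h + r)) -> vanishing n (val h).
Proof.
move=> hr hv i j; elim: j i => [|j IH] i ij.
all: have := hv i.+1; rewrite val_germD val_germM val_line.
all: rewrite mulrBl -scalerAl => /(_ _ ij).
all: rewrite fps2_addE fps2_subE fps2_scaleE !monomial_mulE hr // addr0 /=.
  by rewrite subn1 mulr0 subr0.
rewrite !subn1 !subn0 /= IH; first by rewrite mulr0 subr0.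
by rewrite addSnnS.
Qed.

(** Repeated division by the line: each quotient loses one order, and each remainder, a series in
    $y$, supplies the term with a pure power of $y$. *)
Lemma order_expansion c n g : vanishing n (val g) ->
  exists B : nat -> germ K,
    g = \sum_(k < n.+1) B k * line c ^+ k * Y ^+ (n - k).
Proof.
elim: n g => [|n IH] g hg.
  by exists (fun=> g); rewrite big_ord1 !expr0 !mulr1.
have [//|//|h [r [gE hr]]] := @germ_division _ c 1 1 g.
rewrite !expr1 in gE; have hh : vanishing n (val h).
  by apply: (@vanishing_line_quotient c n h r) => //; rewrite -gE.
have hr' : vanishing n.+1 (val r).
  have -> : r = g - line c * h by rewrite gE addrAC subrr add0r.
  rewrite val_germB; apply: vanishingD => //; apply: vanishingN.
  rewrite val_germM -add1n; apply: vanishingM => //.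
  exact: vanishing_line.
have [|r' [rE _]] := @monomial_dvd _ 0 n.+1 r.
  move=> i j /=; rewrite -ltnNge => jn; case: i => [|i]; last exact: hr.
  exact: hr'.
have [B hE] := IH h hh.
(* Multiplying the expansion of [h] by the line shifts its indices by one and frees index 0 for the
   remainder. *)
exists (fun k => if k is k'.+1 then B k' else r').
rewrite big_ord_recl expr0 mulr1 subn0 gE addrC rE expr0 mul1r mulrC; congr (_ + _).
rewrite hE mulr_sumr; apply: eq_bigr => k _.
by rewrite lift0 subSS exprS; ring.
Qed.

(** [c] is chosen so that the line is not in the tangent cone. On this line the terms with [k > 0]
    vanish, so the nonzero coefficient of $t^n$ is the constant term of [B 0]. *)
Lemma transversal_expansion n f : order_is n (val f) ->
  exists c, pullback c 1 1 1 (val f) 0%N n <> 0 /\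
  exists B : nat -> germ K, germ_unit (B 0%N) /\
    f = \sum_(k < n.+1) B k * line c ^+ k * Y ^+ (n - k).
Proof.
move=> of_; have /nonroot_exists [c fc] := order_homogeneous_part of_.
rewrite -pullback_line in fc; exists c; split; first exact/eqP.
have [B fE] := order_expansion c of_.1; exists B; split=> //.
apply/germ_unitP => B0; case/eqP: fc; rewrite fE big_ord_recl expr0 mulr1 subn0.
rewrite val_germD pullbackD val_germM pullbackM // pullback_Y expr1n scale1r mul1n.
rewrite (_ : \sum_(_ < _) _ =
  line c * \sum_(k < n) B k.+1 * line c ^+ k * Y ^+ (n - k.+1)); last first.
  by rewrite mulr_sumr; apply: eq_bigr => k _; rewrite lift0 exprS; ring.
rewrite val_germM pullbackM // pullback_line_eq0 mul0r addr0 mulrC monomial_mulE.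
rewrite leqnn /= subnn /pullback /= !big_ord1 /=.
by rewrite B0 !mulr0.
Qed.

Lemma independent0 f : independent_in_normalization f 0.
Proof.
exists 1, (fun=> 0); split=> [g|[]//|t _ []//].
by rewrite mul1r.
Qed.

(* For a line u = 0 transversal to the tangent cone, f is homogeneous of degree
   m in u and y with unit coefficient at y^m, so that y / u is integral; so are
   its multiples y^(k+1) / u, which are independent modulo O because f = 0 meets
   the line with multiplicity m. *)
Lemma independent_order f m : order_is m (val f) ->
  independent_in_normalization f m.-1.
Proof.
move=> of_; have [c [fc [B [[V BV] fE]]]] := transversal_expansion of_.
have u0 : line c <> 0.
  move/(congr1 (fun g : germ K => val g 1%N 0%N)) => /eqP.
  by rewrite val_line fps2_subE fps2_scaleE /monomial /= mulr0 subr0 oner_eq0.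
exists (line c), (fun k => Y ^+ k.+1); split.
(* If $ug=fh$, restriction to the line $u=0$, on which [f] is not zero, shows that $u$ divides [h];
   then $u$ is cancelled. *)
- move=> g [h E].
  have ph : pullback c 1 1 1 (val h) = 0.
    apply: (@fps2_mulI _ (pullback c 1 1 1 (val f))); first by move=> pf; rewrite pf in fc.
    by rewrite -pullbackM // -val_germM -E val_germM pullbackM // pullback_line_eq0 mul0r.
  have [h' hE] := line_dvd ph; exists h'; apply/eqP; rewrite -subr_eq0; apply/eqP.
  by apply: (germ_mulI u0); rewrite mulrBr E hE; ring.
(* The expansion of [f], multiplied by the inverse [V] of [B 0] and by $y^{km}$, is a monic equation
   of degree [m] for $y^{k+1}/u$. *)
- move=> k; exists m, (fun j => V * B (m - j)%N * Y ^+ (k * (m - j))).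
  exists (V * Y ^+ (k * m)); rewrite fE big_ord_recl expr0 mulr1 subn0 mulrDl.
  congr (_ + _).
    have -> : B 0%N * Y ^+ m * (V * Y ^+ (k * m)) =
      (B 0%N * V) * (Y ^+ m * Y ^+ (k * m)) by ring.
    by rewrite BV mul1r -exprD -exprM mulSn.
  (* The expansion runs over powers of the line, the integral equation over powers of the numerator;
     hence the reversal. *)
  rewrite mulr_suml (reindex_inj rev_ord_inj); apply: eq_bigr => j _.
  rewrite lift0 /= subKn //.
  have -> : Y ^+ (k * m) = Y ^+ (k * j.+1) * Y ^+ (k * (m - j.+1)).
    by rewrite -exprD -mulnDr subnKC.
  by rewrite -exprM mulSn exprD; ring.
(* On the line, a relation is a polynomial in $t$ of degree less than [m] that is a multiple of the
   restriction of [f], which vanishes to order [m]. *)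
- move=> t [g [h E]] k.
  have pE : \sum_(j < m.-1) t j *: monomial K 0 j.+1 =
      pullback c 1 1 1 (val f) * pullback c 1 1 1 (val h).
    rewrite -pullbackM // -val_germM -E val_germB pullbackB val_germM pullbackM //.
    rewrite pullback_line_eq0 mulr0 subr0.
    have -> : val (\sum_(j < m.-1) t j *: Y ^+ j.+1) =
      \sum_(j < m.-1) t j *: val (Y ^+ j.+1) by rewrite raddf_sum.
    rewrite raddf_sum; apply: eq_bigr => j _.
    by rewrite /= pullbackZ pullback_Y expr1n scale1r mul1n.
  have : (pullback c 1 1 1 (val f) * pullback c 1 1 1 (val h)) 0%N k.+1 = 0.
    apply: (vanishingMr (n := m)); first by apply: vanishing_pullback => //; case: of_.
    by have := ltn_ord k; lia.
  rewrite -pE fps2_sumE (bigD1 k) //= fps2_scaleE /monomial !eqxx /= mulr1.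
  rewrite big1 ?addr0 // => j jk; rewrite fps2_scaleE eqSS /=.
  by rewrite eq_sym val_eqE (negPf jk) mulr0.
Qed.

End Normalization.

(** * Automorphisms of the ring of germs preserve orders *)

Section Automorphism.
Variable K : numFieldType.
Implicit Types (f g h u : germ K) (c : K) (m n : nat).

Local Notation X := (germX K).
Local Notation Y := (germY K).

(** [phi] is not given as a substitution, but it commutes with the finite expansion of [g] over the
    $x^ky^{n-k}$, obtained from the line with $c=0$. *)
Lemma rmorphism_vanishing (phi : {rmorphism germ K -> germ K}) n g :
  vanishing 1 (val (phi X)) -> vanishing 1 (val (phi Y)) ->
  vanishing n (val g) -> vanishing n (val (phi g)).
Proof.
move=> hX hY /(order_expansion 0) [B ->]; rewrite rmorph_sum.
have -> (F : 'I_n.+1 -> germ K) : val (\sum_k F k) = \sum_k val (F k).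
  by rewrite raddf_sum.
apply: vanishing_sum => k _; rewrite scale0r subr0 !rmorphM !rmorphXn -mulrA.
apply: vanishingMl; apply: (vanishingW (n := k + (n - k))).
  by rewrite subnKC // leq_ord.
apply: vanishingM.
  by have := vanishingX (n := k) hX; rewrite mul1n.
by have := vanishingX (n := n - k) hY; rewrite mul1n.
Qed.

Lemma rmorphism_unit (phi : {rmorphism germ K -> germ K}) g :
  germ_unit g -> germ_unit (phi g).
Proof. by move=> [h gh]; exists (phi h); rewrite -rmorphM gh rmorph1. Qed.

Lemma bijective_rmorphism_inv (phi : {rmorphism germ K -> germ K}) :
  bijective phi ->
  exists psi : {rmorphism germ K -> germ K}, cancel phi psi /\ cancel psi phi.
Proof.
move=> [psi pK Kp].
pose A := GRing.isZmodMorphism.Build _ _ psi (can2_zmod_morphism pK Kp).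
pose M := GRing.isMonoidMorphism.Build _ _ psi (can2_monoid_morphism pK Kp).
pose psi' : {rmorphism germ K -> germ K} := HB.pack psi A M.
by exists psi'.
Qed.

Lemma automorphism_unit (phi : {rmorphism germ K -> germ K}) g :
  bijective phi -> germ_unit (phi g) <-> germ_unit g.
Proof.
move=> /bijective_rmorphism_inv [psi [pK Kp]]; split; last exact: rmorphism_unit.
by move/(rmorphism_unit psi); rewrite pK.
Qed.

(** An automorphism preserves nonunits, so [phi X] and [phi Y] stay in the maximal ideal. *)
Lemma automorphism_vanishing (phi : {rmorphism germ K -> germ K}) n g :
  bijective phi -> vanishing n (val g) -> vanishing n (val (phi g)).
Proof.
move=> bphi; apply: rmorphism_vanishing; apply/germ_nonunitP; rewrite automorphism_unit //.
  by apply/germ_nonunitP => -[|i] [|j].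
by apply/germ_nonunitP => -[|i] [|j].
Qed.

Lemma automorphism_order (phi : {rmorphism germ K -> germ K}) n g :
  bijective phi -> order_is n (val g) -> order_is n (val (phi g)).
Proof.
move=> bphi [hn nn]; split; first exact: automorphism_vanishing.
move=> h; apply: nn; have [psi [pK Kp]] := bijective_rmorphism_inv bphi.
rewrite -[g]pK; apply: automorphism_vanishing h.
by exists phi.
Qed.

End Automorphism.

(** * Branches and virtual cusps *)

Section Branches.
Variable K : numFieldType.
Implicit Types (f g h u : germ K) (s : seq (germ K)) (m n : nat).

Local Notation X := (germX K).
Local Notation Y := (germY K).

Lemma has_orderP g n : has_order g n <-> order_is n (val g).
Proof.
split=> [[[i [j [ijn gij]]] h]|[h ng]].
  by split=> // /(_ i j); rewrite ijn ltnSn => /(_ isT).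
split=> //; apply: contrapT => H; apply: ng => i j; rewrite ltnS leq_eqVlt.
case/orP=> [/eqP ijn|]; last exact: h.
by apply: contrapT => gij; apply: H; exists i, j.
Qed.

Lemma mult_order g n : order_is n (val g) -> mult g = n.
Proof.
move=> gn; apply: (@order_is_uniq _ _ _ (val g)) => //; apply/has_orderP.
by apply: xgetPex; exists n; apply/has_orderP.
Qed.

Lemma mult_irreducible g : irreducible_germ g ->
  order_is (mult g) (val g) /\ (0 < mult g)%N.
Proof.
move=> [g0 ng _]; have [n gn] := germ_neq0_order g0.
rewrite (mult_order gn); split=> //; case: n gn => // g0'.
by case: ng; apply/germ_unit_order.
Qed.

Lemma order_branches f s : branch_decomposition f s ->
  order_is (\sum_(g <- s) mult g) (val f).
Proof.
move=> [irr [u uu ->]]; rewrite -[X in order_is X]add0n val_germM.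
apply: order_isM; first exact/germ_unit_order.
elim: s irr => [|g s IH] irr.
  by rewrite !big_nil; apply/germ_unit_order; exists 1; rewrite mulr1.
rewrite !big_cons val_germM; apply: order_isM.
  by case: (mult_irreducible (irr g (mem_head _ _))).
by apply: IH => h hs; apply: irr; rewrite inE hs orbT.
Qed.

Lemma sum_mult_sub1 s :
  \sum_(g <- s) ((mult g)%:Z - 1) = (\sum_(g <- s) mult g)%N%:Z - (size s)%:Z.
Proof.
elim: s => [|g s IH]; first by rewrite !big_nil.
by rewrite !big_cons IH /= PoszD intS; ring.
Qed.

(** The decomposition chosen by [branches] may differ from [s], whence [s']. Its multiplicities add
    up to the order of [f], so only its length has to be found. *)
Lemma virtual_cusps_at_decomposition f s n :
  branch_decomposition f s -> order_is n (val f) ->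
  exists2 s', branch_decomposition f s' & virtual_cusps_at f = n%:Z - (size s')%:Z.
Proof.
move=> bs fn.
have bs' : branch_decomposition f (branches f) by apply: xgetPex; exists s.
exists (branches f) => //; rewrite /virtual_cusps_at sum_mult_sub1.
by rewrite (order_is_uniq (order_branches bs') fn).
Qed.

(** The default [[::]] of [branches] gives an empty sum; [f = 0] is such a case. *)
Lemma virtual_cusps_at_no_branches f :
  ~ (exists s, branch_decomposition f s) -> virtual_cusps_at f = 0.
Proof.
move=> nex; rewrite /virtual_cusps_at /branches.
rewrite (@xgetPN _ _ (branch_decomposition f)) ?big_nil //.
by move=> s bs; apply: nex; exists s.
Qed.

Lemma virtual_cusps_at_ge0 f : 0 <= virtual_cusps_at f.
Proof.
case: (pselect (exists s, branch_decomposition f s)) => [ex|nex]; last first.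
  by rewrite virtual_cusps_at_no_branches.
have [irr _] : branch_decomposition f (branches f) by exact: xgetPex.
rewrite /virtual_cusps_at big_seq sumr_ge0 // => g /irr /mult_irreducible [_ g0].
by rewrite subr_ge0 lez_nat.
Qed.

(** Take [n] one less than the order of [f]: as soon as there is a branch, subtracting the number of
    branches subtracts at least 1. *)
Lemma virtual_cusps_at_le f : exists n : nat,
  independent_in_normalization f n /\ virtual_cusps_at f <= n%:Z.
Proof.
case: (pselect (exists s, branch_decomposition f s)) => [[s0 bs0]|nex]; last first.
  exists 0%N; split; first exact: independent0.
  by rewrite virtual_cusps_at_no_branches.
have [s bs ->] := virtual_cusps_at_decomposition bs0 (order_branches bs0).
exists (\sum_(g <- s0) mult g).-1; split.
  exact: independent_order (order_branches bs0).
rewrite (order_is_uniq (order_branches bs0) (order_branches bs)).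
(* Without branches the order is 0, and so is its truncated predecessor. *)
case: s bs => [|g s] bs; first by rewrite big_nil.
by rewrite /= lerBlDr -PoszD lez_nat; lia.
Qed.

Lemma irreducible_branches f s : irreducible_germ f -> branch_decomposition f s ->
  size s = 1%N.
Proof.
move=> [_ nf fP] [irr [u uu fE]]; case: s irr fE => [|g [|g' s]] irr fE //.
  by case: nf; rewrite fE big_nil mulr1.
have [_ ng _] := irr g (mem_head _ _).
have [_ ng' _] : irreducible_germ g' by apply: irr; rewrite !inE eqxx orbT.
have := fP (u * g) (g' * \prod_(h <- s) h).
rewrite fE !big_cons !mulrA => /(_ erefl) [] /germ_unitM []; first by move=> _ /ng.
by move=> /ng'.
Qed.

(** The positive multiplicities add up to 2, so there are one or two branches; a single one would be
    irreducible and yet equal to [g * h] up to a unit. *)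
Lemma order2_branches f g h s : order_is 2 (val f) -> f = g * h ->
  ~ germ_unit g -> ~ germ_unit h -> branch_decomposition f s -> size s = 2%N.
Proof.
move=> f2 fE ng nh bs; have := order_is_uniq (order_branches bs) f2.
have [irr [u [V uV] fE']] := bs.
case: s bs irr fE' => [|g1 [|g2 [|g3 s]]] bs irr fE'; rewrite ?big_nil //.
  have [_ _ /(_ (V * g) h)] := irr g1 (mem_head _ _).
  rewrite -mulrA -fE fE' big_seq1 mulrA [V * u]mulrC uV mul1r => /(_ erefl).
  by case=> [/germ_unitM [_ /ng]|/nh].
have m0 g' : g' \in [:: g1, g2, g3 & s] -> (0 < mult g')%N.
  by move=> /irr /mult_irreducible [].
rewrite !big_cons; have := m0 g1; have := m0 g2; have := m0 g3.
by rewrite !inE !eqxx ?orbT => /(_ isT) ? /(_ isT) ? /(_ isT) ?; lia.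
Qed.

(** A product of two nonunits lies in the square of the maximal ideal. *)
Lemma irreducible_order1 g : order_is 1 (val g) -> irreducible_germ g.
Proof.
move=> [g1 ng1]; split; first by move=> g0; apply: ng1; rewrite g0; exact: vanishing0.
  by apply/germ_nonunitP.
move=> a b gE; apply: contrapT => /not_orP [/germ_nonunitP na /germ_nonunitP nb].
by apply: ng1; rewrite gE; exact: (vanishingM na nb).
Qed.

Lemma irreducible_transport (phi : {rmorphism germ K -> germ K}) u g :
  bijective phi -> germ_unit u -> irreducible_germ g -> irreducible_germ (u * phi g).
Proof.
move=> bphi uu [g0 ng gP]; have [psi [pK Kp]] := bijective_rmorphism_inv bphi.
have [V uV] := uu.
split.
- have u0 : u <> 0 by move=> E; move: uu => /germ_unitP; rewrite E.
  move/(germ_mulI u0) => E; apply: g0; apply: (can_inj pK).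
  by rewrite E rmorph0.
- by move/germ_unitM => [_]; rewrite automorphism_unit.
move=> a b E; have [] := gP (psi (V * a)) (psi b).
- by rewrite -rmorphM -mulrA -E mulrA [V * u]mulrC uV mul1r pK.
- rewrite -(automorphism_unit _ bphi) Kp => /germ_unitM [_]; by left.
- by rewrite -(automorphism_unit _ bphi) Kp; right.
Qed.

Lemma order_X : order_is 1 (val X).
Proof.
split=> [|/(_ 1%N 0%N isT) /eqP]; last by rewrite val_germX /monomial /= oner_eq0.
exact: (@vanishing_monomial _ 1 0).
Qed.

Lemma order_Y : order_is 1 (val Y).
Proof.
split=> [|/(_ 0%N 1%N isT) /eqP]; last by rewrite val_germY /monomial /= oner_eq0.
exact: (@vanishing_monomial _ 0 1).
Qed.

Lemma order_cusp : order_is 2 (val (X ^+ 2 - Y ^+ 3)).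
Proof.
rewrite val_germB !val_germX_exp; apply: order_vanishing.
  exact: (order_isX (m := 1) 2 order_X).
by apply: vanishingN; exact: (vanishingX (n := 3) order_Y.1).
Qed.

(** For two nonunit factors, the coefficients of $x^2$, $xy$ and $y^2$ force both linear parts to be
    multiples of $x$; the coefficient of $y^3$ is then 0 instead of $-1$. *)
Lemma irreducible_cusp : irreducible_germ (X ^+ 2 - Y ^+ 3).
Proof.
have c2 := order_cusp.
split; first by move=> c0; case: c2 => _; rewrite c0; apply.
  by move=> /germ_unit_order c0; have := order_is_uniq c0 c2.
move=> a b /(congr1 (fun g : germ K => val g)) E.
apply: contrapT => /not_orP [/germ_nonunitP na /germ_nonunitP nb].
have a00 := na 0%N 0%N isT; have b00 := nb 0%N 0%N isT.
have coef i j : monomial K 2 0 i j - monomial K 0 3 i j =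
    \sum_(k < i.+1) \sum_(l < j.+1) val a k l * val b (i - k)%N (j - l)%N.
  by rewrite -fps2_mul_coef -val_germM -E val_germB !val_germX_exp !monomialX.
have c20 : val a 1%N 0%N * val b 1%N 0%N = 1.
  have := coef 2%N 0%N; rewrite /monomial /= !big_ord_recl !big_ord0 /= a00 b00.
  by rewrite !mul0r !mulr0 ?subr0 !addr0 !add0r ?oppr0 => <-.
have c02 : val a 0%N 1%N * val b 0%N 1%N = 0.
  have := coef 0%N 2%N; rewrite /monomial /= !big_ord_recl !big_ord0 /= a00 b00.
  by rewrite !mul0r !mulr0 ?subr0 !addr0 !add0r ?oppr0 => <-.
have c11 : val a 0%N 1%N * val b 1%N 0%N + val a 1%N 0%N * val b 0%N 1%N = 0.
  have := coef 1%N 1%N; rewrite /monomial /= !big_ord_recl !big_ord0 /= a00 b00.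
  by rewrite !mul0r !mulr0 ?subr0 !addr0 !add0r ?oppr0 => <-.
have c03 : val a 0%N 1%N * val b 0%N 2%N + val a 0%N 2%N * val b 0%N 1%N = -1.
  have := coef 0%N 3%N; rewrite /monomial /= !big_ord_recl !big_ord0 /= a00 b00.
  by rewrite !mul0r !mulr0 !addr0 !add0r => <-.
have a10 : val a 1%N 0%N != 0.
  by apply/eqP => a10; move/eqP: c20; rewrite a10 mul0r eq_sym oner_eq0.
have b10 : val b 1%N 0%N != 0.
  by apply/eqP => b10; move/eqP: c20; rewrite b10 mulr0 eq_sym oner_eq0.
have [a01 b01] : val a 0%N 1%N = 0 /\ val b 0%N 1%N = 0.
  move/eqP: c02; rewrite mulf_eq0 => /orP [] /eqP E0; move/eqP: c11; rewrite E0.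
    by rewrite mul0r add0r mulf_eq0 (negPf a10) => /eqP.
  by rewrite mulr0 addr0 mulf_eq0 (negPf b10) orbF => /eqP.
by move/eqP: c03; rewrite a01 b01 mul0r mulr0 addr0 eq_sym oppr_eq0 oner_eq0.
Qed.

(** * Virtual cusps of the images of the two models under analytic equivalence *)

Section Transport.
Variables (phi : {rmorphism germ K -> germ K}) (u : germ K).
Hypotheses (bphi : bijective phi) (uu : germ_unit u).

Lemma order_transport n g : order_is n (val g) -> order_is n (val (u * phi g)).
Proof.
move=> gn; rewrite -[n]add0n val_germM; apply: order_isM.
  exact/germ_unit_order.
exact: automorphism_order.
Qed.

Lemma virtual_cusps_at_cusp : virtual_cusps_at (u * phi (X ^+ 2 - Y ^+ 3)) = 1.
Proof.
have irr := irreducible_transport bphi uu irreducible_cusp.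
have [|s bs ->] := virtual_cusps_at_decomposition (s := [:: u * phi (X ^+ 2 - Y ^+ 3)])
    _ (order_transport order_cusp).
  split; first by move=> g; rewrite inE => /eqP ->.
  by exists 1; rewrite ?big_seq1 ?mul1r //; exists 1; rewrite mulr1.
by rewrite (irreducible_branches irr bs).
Qed.

Lemma virtual_cusps_at_node : virtual_cusps_at (u * phi (X * Y)) = 0.
Proof.
have oX : order_is 1 (val (phi X)) := automorphism_order bphi order_X.
have oY : order_is 1 (val (phi Y)) := automorphism_order bphi order_Y.
have o2 : order_is 2 (val (u * phi (X * Y))).
  by apply: order_transport; rewrite val_germM; exact: (order_isM order_X order_Y).
have [|s bs ->] := virtual_cusps_at_decomposition (s := [:: phi X; phi Y]) _ o2.
  split.
    by move=> g; rewrite !inE => /orP [] /eqP ->; exact: irreducible_order1.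
  by exists u; rewrite // big_cons big_seq1 rmorphM.
rewrite (@order2_branches _ (u * phi X) (phi Y) s o2) ?subrr //.
- by rewrite rmorphM mulrA.
- by move/germ_unitM => [_ /germ_unit_order h]; have := order_is_uniq h oX.
- by move/germ_unit_order => h; have := order_is_uniq h oY.
Qed.

End Transport.

End Branches.

(** * The delta invariant of cusps and nodes *)

Section UpperBound.
Variable K : numFieldType.
Implicit Types (f g h u a b : germ K) (m n : nat).

Local Notation X := (germX K).
Local Notation Y := (germY K).

Lemma germ_dvd_transport (phi psi : {rmorphism germ K -> germ K}) u f z :
  cancel phi psi -> cancel psi phi -> germ_unit u ->
  germ_dvd (u * phi f) z <-> germ_dvd f (psi z).
Proof.
move=> pK Kp [V uV]; split=> -[h E].
  by exists (psi (u * h)); apply: (can_inj pK); rewrite Kp rmorphM Kp E; ring.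
exists (V * phi h); apply: (can_inj Kp); rewrite E; apply: (can_inj pK).
rewrite Kp rmorphM.
have -> : u * phi f * (V * phi h) = (u * V) * (phi f * phi h) by ring.
by rewrite uV mul1r.
Qed.

Lemma independent_transport (phi : {lrmorphism germ K -> germ K}) u f n :
  bijective phi -> germ_unit u ->
  independent_in_normalization (u * phi f) n -> independent_in_normalization f n.
Proof.
move=> bphi uu; have [psi [pK Kp]] := bijective_rmorphism_inv bphi.
have dvdE z := germ_dvd_transport f z pK Kp uu.
move=> [b [a [nzd int ind]]]; exists (psi b), (fun k => psi (a k)); split.
- move=> g; rewrite -[g]pK -rmorphM -!dvdE; exact: nzd.
- move=> k; have [m [c /dvdE hc]] := int k; exists m, (fun j => psi (c j)).
  move: hc; rewrite rmorphD rmorphXn rmorph_sum.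
  by under eq_bigr do rewrite !rmorphM !rmorphXn.
move=> t [g hg]; apply: ind; exists (phi g); apply/dvdE.
rewrite rmorphB rmorphM pK rmorph_sum.
(* [psi] is packaged only as a ring morphism; its linearity is recovered from that of [phi] by
   injectivity. *)
rewrite (_ : \sum_(k < n) psi (t k *: a k) = \sum_(k < n) t k *: psi (a k)) //.
by apply: eq_bigr => k _; apply: (can_inj pK); rewrite Kp; apply: esym;
  apply: (etrans (linearZ_LR phi _ _)); congr (_ *: _); exact: Kp.
Qed.

(** [L b a l] stands for a linear functional with value [l] on $a/b$, given as a relation because
    its values come from quotients known only to exist. Of any two fractions a nontrivial
    combination lies in its kernel, hence in O. *)
Lemma independent_le1 f n (L : germ K -> germ K -> K -> Prop) :
  (forall b a, nonzerodivisor f b -> integral_fraction f a b -> exists l, L b a l) ->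
  (forall b t a l a' l', L b a l -> L b a' l' -> L b (t *: a + a') (t * l + l')) ->
  (forall b a, L b a 0 -> exists g, germ_dvd f (a - g * b)) ->
  independent_in_normalization f n -> (n <= 1)%N.
Proof.
move=> Lex Llin L0 [b [a [nzd int ind]]]; rewrite leqNgt; apply/negP => n2.
pose i0 : 'I_n := Ordinal (ltnW n2); pose i1 : 'I_n := Ordinal n2.
have [l0 La0] := Lex _ _ nzd (int i0); have [l1 La1] := Lex _ _ nzd (int i1).
have sum1 i : \sum_(k < n) (k == i)%:R *: a k = a i.
  rewrite (bigD1 i) //= eqxx scale1r big1 ?addr0 // => k /negPf ->.
  by rewrite scale0r.
have [l00|l00] := eqVneq l0 0.
  have H : exists g, germ_dvd f (\sum_(k < n) (k == i0)%:R *: a k - g * b).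
    by rewrite sum1; apply: L0; rewrite -l00.
  by have /eqP := ind _ H i0; rewrite eqxx oner_eq0.
(* [s] makes the value of the functional on $s a_0+a_1$ equal to zero. *)
pose s := - (l1 / l0); pose t (k : 'I_n) : K := s * (k == i0)%:R + (k == i1)%:R.
have H : exists g, germ_dvd f (\sum_(k < n) t k *: a k - g * b).
  have -> : \sum_(k < n) t k *: a k = s *: a i0 + a i1.
    rewrite -2!sum1 scaler_sumr -big_split; apply: eq_bigr => k _.
    by rewrite /= scalerDl scalerA.
  apply: L0; have -> : 0 = s * l0 + l1 by rewrite /s mulNr divfK // addNr.
  exact: Llin.
by have /eqP := ind _ H i1; rewrite /t eqxx mulr0 add0r oner_eq0.
Qed.

Lemma mul_row0 (a a' b : fps2 K) n : (forall j, a 0%N j = a' 0%N j) ->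
  (a * b) 0%N n = (a' * b) 0%N n.
Proof.
move=> E; rewrite !fps2_mul_coef !big_ord1; apply: eq_bigr => l _.
by rewrite E.
Qed.

(** * Integral fractions restricted to one parametrized branch *)

Section OneBranch.
Variables (al be : K) (p q : nat).
Local Notation psi := (pullback al be p.+1 q.+1).

(** Valuation argument: if [a] had order $d<e$ on the branch, $a^n$ would have order $dn$ and each
    other term of the integral equation order at least $dk+e(n-k)>dn$, so the sum could not
    vanish. *)
Lemma integral_vanishing f a b e : psi (val f) = 0 -> integral_fraction f a b ->
  vanishing e (psi (val b)) -> vanishing e (psi (val a)).
Proof.
move=> f0 [n [c [h E]]] hb; apply: contrapT => na.
have [a0|a0] := pselect (psi (val a) = 0).
  by apply: na; rewrite a0; exact: vanishing0.
have [d ad] := fps2_neq0_order a0.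
have de : (d < e)%N.
  by rewrite ltnNge; apply/negP => ed; apply: na; exact: vanishingW ed ad.1.
have sE : psi (val a) ^+ n +
    \sum_(k < n) psi (val (c k)) * psi (val a) ^+ k * psi (val b) ^+ (n - k) = 0.
  transitivity (psi (val (f * h))); last by rewrite val_germM pullbackM // f0 mul0r.
  rewrite -E val_germD pullbackD; congr (_ + _).
    by rewrite val_germX_exp rmorphXn.
  have -> : val (\sum_(k < n) c k * a ^+ k * b ^+ (n - k)) =
    \sum_(k < n) val (c k * a ^+ k * b ^+ (n - k)) by rewrite raddf_sum.
  rewrite raddf_sum; apply: eq_bigr => k _.
  by rewrite !val_germM !val_germX_exp /= !rmorphM !rmorphXn.
have sum_vanishing : vanishing (d * n).+1
    (\sum_(k < n) psi (val (c k)) * psi (val a) ^+ k * psi (val b) ^+ (n - k)).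
  apply: vanishing_sum => k _; rewrite -mulrA; apply: vanishingMl.
  apply: (vanishingW (n := d * k + e * (n - k))); last first.
    by apply: vanishingM; apply: vanishingX => //; exact: ad.1.
  by have := ltn_ord k; nia.
have := order_vanishing (order_isX n ad) sum_vanishing.
by rewrite sE => -[_]; apply; exact: vanishing0.
Qed.

(** With [e] the order of the pullback of [b], both pullbacks are divisible by $t^e$, and the
    cofactor for [b] is a unit. *)
Lemma integral_quotient f a b : psi (val f) = 0 -> psi (val b) <> 0 ->
  integral_fraction f a b -> exists Q : germ K, psi (val a) = val Q * psi (val b).
Proof.
move=> f0 b0 int; have [e be_] := fps2_neq0_order b0.
have ae := integral_vanishing f0 int be_.1.
pose A : germ K := Germ (pullback_convergent al be (ltn0Sn p) (ltn0Sn q) (valP a)).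
pose B : germ K := Germ (pullback_convergent al be (ltn0Sn p) (ltn0Sn q) (valP b)).
have [|A' [AE _]] := @monomial_dvd _ 0 e A.
  by move=> [|i] j //; rewrite -ltnNge => je; apply: ae.
have [|B' [BE _]] := @monomial_dvd _ 0 e B.
  by move=> [|i] j //; rewrite -ltnNge => je; apply: be_.1.
have [V BV] : germ_unit B'.
  apply: contrapT => /germ_nonunitP hB'; apply: be_.2.
  change (vanishing e.+1 (val B)); rewrite BE val_germM -addn1.
  by apply: vanishingM => //; rewrite val_XnYm; exact: (@vanishing_monomial _ 0 e).
exists (A' * V); change (val A = val (A' * V * B)); congr val.
rewrite AE BE.
have -> : A' * V * (X ^+ 0 * Y ^+ e * B') = X ^+ 0 * Y ^+ e * A' * (B' * V) by ring.
by rewrite BV mulr1.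
Qed.

End OneBranch.

Lemma independent_cusp n :
  independent_in_normalization (X ^+ 2 - Y ^+ 3) n -> (n <= 1)%N.
Proof.
pose psi := @pullback K 1 1 3 2.
have f0 : psi (val (X ^+ 2 - Y ^+ 3)) = 0.
  by rewrite val_germB /psi pullbackB pullback_X pullback_Y !expr1n subrr.
apply: (@independent_le1 _ _ (fun b a l => exists Q : germ K,
    psi (val a) = val Q * psi (val b) /\ val Q 0%N 1%N = l)).
- move=> b a nzd int.
  (* If [b] vanished on the curve, the equation of the cusp would divide [b * 1], hence 1. *)
  have b0 : psi (val b) <> 0.
    move=> /cusp_dvd fb; have [h E] : germ_dvd (X ^+ 2 - Y ^+ 3) 1.
      by apply: nzd; rewrite mulr1.
    have [_ nu _] := @irreducible_cusp K; apply: nu; by exists h.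
  have [Q QE] := integral_quotient f0 b0 int.
  by exists (val Q 0%N 1%N), Q.
- move=> b t a l a' l' [Q [QE <-]] [Q' [QE' <-]]; exists (t *: Q + Q').
  split=> //; rewrite val_germD val_germZ /psi pullbackD pullbackZ -/psi.
  by rewrite QE QE' val_germD val_germZ mulrDl scalerAl.
move=> b a [Q [QE Q1]].
(* Every exponent except 1 is $3i+2j$ for exactly one pair with $i<2$, so these coefficients define
   a germ whose pullback is the series given by [Q], its coefficient of $t$ being 0. *)
have hc : (fun i j => if (i < 2)%N then val Q 0%N (3 * i + 2 * j)%N else 0)
    \in @convergent K.
  apply: (convergent_restrict (fun i _ => (i < 2)%N)).
  apply: (@convergent_shift _ _ (fun _ _ => 0%N) (fun i j => 3 * i + 2 * j)%N 4
    _ (valP Q)) => i j; lia.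
pose g : germ K := Germ hc; exists g.
have gQ j : psi (val g) 0%N j = val Q 0%N j.
  have hg i l : (2 <= i)%N -> val g i l = 0 by move=> i2; rewrite /= ltnNge i2.
  have [jE|[j1|jE]] : j = (3 * 0 + 2 * j./2)%N \/
      (j = 1%N \/ j = (3 * 1 + 2 * (j - 3)./2)%N) by lia.
  - by rewrite jE /psi pullback_cuspidal // -jE.
  - rewrite j1 Q1 /psi /pullback /=; apply: big1 => k _; apply: big1 => l _.
    by case: eqP => [E|]; [lia|rewrite !mul0r].
  - by rewrite jE /psi pullback_cuspidal // -jE.
apply: cusp_dvd; rewrite val_germB val_germM pullbackB pullbackM // -/psi QE.
apply: fps2P => -[|i] j; rewrite fps2_subE; last by rewrite -QE -pullbackM // subrr.
by rewrite (mul_row0 _ _ gQ) subrr.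
Qed.

Lemma independent_node n : independent_in_normalization (X * Y) n -> (n <= 1)%N.
Proof.
pose px := @pullback K 1 0 1 1; pose py := @pullback K 0 1 1 1.
have pxY : px (val Y) = 0 by rewrite /px -[Y]expr1 pullback_Y expr1 scale0r.
have pyX : py (val X) = 0 by rewrite /py -[X]expr1 pullback_X expr1 scale0r.
have fx : px (val (X * Y)) = 0 by rewrite val_germM /px pullbackM // -/px pxY mulr0.
have fy : py (val (X * Y)) = 0 by rewrite val_germM /py pullbackM // -/py pyX mul0r.
(* Multiples of $xy$ vanish to order 2. *)
have not_dvd z : order_is 1 (val z) -> ~ germ_dvd (X * Y) z.
  move=> [_ nz] [h zE]; apply: nz; rewrite zE val_germM; apply: vanishingMr.
  by rewrite val_germM; exact: (order_isM (order_X K) (order_Y K)).1.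
apply: (@independent_le1 _ _ (fun b a l => exists Q Q' : germ K,
    [/\ px (val a) = val Q * px (val b), py (val a) = val Q' * py (val b) &
      l = val Q 0%N 0%N - val Q' 0%N 0%N])).
- move=> b a nzd int.
  have bx : px (val b) <> 0.
    (* If [b] vanished on the $x$-axis, $bx$ would vanish on both axes, so $xy$ would divide $bx$,
       hence $x$. *)
    move=> b0; apply: (not_dvd _ (order_X K)); apply: nzd; apply: node_dvd.
      by rewrite val_germM pullbackM // -/px b0 mul0r.
    by rewrite val_germM pullbackM // -/py pyX mulr0.
  have by_ : py (val b) <> 0.
    move=> b0; apply: (not_dvd _ (order_Y K)); apply: nzd; apply: node_dvd.
      by rewrite val_germM pullbackM // -/px pxY mulr0.
    by rewrite val_germM pullbackM // -/py b0 mul0r.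
  have [Q QE] := integral_quotient fx bx int.
  have [Q' QE'] := integral_quotient fy by_ int.
  by exists (val Q 0%N 0%N - val Q' 0%N 0%N), Q, Q'.
- move=> b t a l a' l' [Q [R [QE RE ->]]] [Q' [R' [QE' RE' ->]]].
  exists (t *: Q + Q'), (t *: R + R'); split.
  + rewrite val_germD val_germZ /px pullbackD pullbackZ -/px.
    by rewrite QE QE' val_germD val_germZ mulrDl scalerAl.
  + rewrite val_germD val_germZ /py pullbackD pullbackZ -/py.
    by rewrite RE RE' val_germD val_germZ mulrDl scalerAl.
  + by rewrite !val_germD !val_germZ !fps2_addE !fps2_scaleE; ring.
move=> b a [Q [R [QE RE /eqP]]]; rewrite eq_sym subr_eq0 => /eqP QR.
have hQ : (fun i j => if j == 0%N then val Q 0%N i else 0) \in @convergent K.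
  apply: (convergent_restrict (fun _ j => j == 0%N)).
  by apply: (@convergent_shift _ _ (fun _ _ => 0%N) (fun i j => i) 1 _ (valP Q))
    => i j; lia.
have hR : (fun i j => if i == 0%N then val R 0%N j else 0) \in @convergent K.
  apply: (convergent_restrict (fun i _ => i == 0%N)).
  by apply: (@convergent_shift _ _ (fun _ _ => 0%N) (fun i j => j) 1 _ (valP R))
    => i j; lia.
(* The series on the two axes agree at the origin, so they are glued by adding them and subtracting
   their common constant term. *)
pose g : germ K := Germ hQ + Germ hR - val R 0%N 0%N *: 1.
have gE i j : val g i j = (if j == 0%N then val Q 0%N i else 0) +
    (if i == 0%N then val R 0%N j else 0) -
    val R 0%N 0%N * ((i == 0%N) && (j == 0%N))%:R by [].
exists g.
have gQ j : px (val g) 0%N j = val Q 0%N j.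
  rewrite /px pullback_xaxis gE /=; case: eqP => [->|_] /=.
    by rewrite mulr1 addrK.
  by rewrite mulr0 addr0 subr0.
have gR j : py (val g) 0%N j = val R 0%N j.
  rewrite /py pullback_yaxis gE /=; case: eqP => [->|_] /=.
    by rewrite mulr1 addrK QR.
  by rewrite mulr0 add0r subr0.
apply: node_dvd; rewrite val_germB val_germM pullbackB pullbackM //.
  rewrite -/px QE; apply: fps2P => -[|i] j; rewrite fps2_subE.
    by rewrite (mul_row0 _ _ gQ) subrr.
  by rewrite -QE /px -pullbackM // subrr.
rewrite -/py RE; apply: fps2P => -[|i] j; rewrite fps2_subE.
  by rewrite (mul_row0 _ _ gR) subrr.
by rewrite -RE /py -pullbackM // subrr.
Qed.

End UpperBound.

(** * Global invariants *)

Section LocalInvariants.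
Variable R : realType.
Implicit Types f : germ R[i].

Local Notation X := (germX R[i]).
Local Notation Y := (germY R[i]).

Lemma delta_ge f n : independent_in_normalization f n -> (n%:R%:E <= delta f)%E.
Proof. by move=> fn; apply: ereal_sup_ubound; exists n. Qed.

Lemma virtual_nodes_at_ge0 f : (0 <= virtual_nodes_at f)%E.
Proof.
rewrite /virtual_nodes_at suber_ge0 //.
have [n [fn cn]] := virtual_cusps_at_le f; apply: le_trans (delta_ge fn).
by rewrite lee_fin -[n%:R]/(n%:~R) ler_int.
Qed.

Lemma delta_eq1 f : order_is 2 (val f) ->
  (forall n, independent_in_normalization f n -> (n <= 1)%N) -> delta f = 1%:E.
Proof.
move=> f2 h; apply/eqP; rewrite eq_le; apply/andP; split.
  by apply: ge_ereal_sup => _ [n fn <-]; rewrite lee_fin lern1 h.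
exact: (delta_ge (independent_order f2)).
Qed.

Lemma ordinary_cusp_invariants f : ordinary_cusp f ->
  virtual_cusps_at f = 1 /\ virtual_nodes_at f = 0%E.
Proof.
move=> [phi [u [bphi uu ->]]].
have c1 := virtual_cusps_at_cusp (phi := phi) bphi uu; split; first exact: c1.
rewrite /virtual_nodes_at c1 delta_eq1 ?subee //.
  by apply: (order_transport (phi := phi) bphi uu); exact: order_cusp.
by move=> n /(independent_transport bphi uu) /independent_cusp.
Qed.

Lemma ordinary_node_invariants f : ordinary_node f ->
  virtual_cusps_at f = 0 /\ virtual_nodes_at f = 1%:E.
Proof.
move=> [phi [u [bphi uu ->]]].
have c0 := virtual_cusps_at_node (phi := phi) bphi uu; split; first exact: c0.
rewrite /virtual_nodes_at c0 delta_eq1 ?sube0 //.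
  apply: (order_transport (phi := phi) bphi uu); rewrite val_germM.
  exact: (order_isM (order_X _) (order_Y _)).
by move=> n /(independent_transport bphi uu) /independent_node.
Qed.

End LocalInvariants.

(* No finiteness is assumed: when B is infinite, both sides are empty sums. *)
Lemma fsbig_indicator (S : Type) (idx : S) (op : S -> S -> S) (T : choiceType)
    (A B : set T) (F : T -> S) (x : S) : x <> idx ->
  (B `<=` A)%classic -> (forall i, B i -> F i = x) ->
  (forall i, A i -> ~ B i -> F i = idx) ->
  \big[op/idx]_(i \in A) F i = \big[op/idx]_(i <- fset_set B) x.
Proof.
(* As [x] differs from [idx], [B] is exactly the support of [F] in [A]. *)
move=> xidx BA FB FA; have -> : finite_support idx A F = fset_set B.
  rewrite /finite_support unlock; congr (enum_fset (fset_set _)).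
  apply/seteqP; split=> i /=; last by move=> Bi; split; [exact: BA|rewrite FB].
  by move=> [Ai Fi]; apply: contrapT => /(FA _ Ai).
apply: eq_big_seq => i; have [fB|nfB] := pselect (finite_set B).
  by rewrite in_fset_set // inE => /FB.
by rewrite /fset_set; case: pselect => // _; rewrite inE.
Qed.

Theorem proposition1 (R : realType) (F : {mpoly R[i][3]}) (redF : reduced_curve F) :
  (0 <= virtual_cusps F /\ (0 <= virtual_nodes F)%E) /\
  (cuspidal F ->
     virtual_cusps F = (num_cusps F)%:Z /\
     virtual_nodes F = ((num_nodes F)%:R)%:E).
Proof.
split.
  split; first by apply: fsumr_ge0 => p _; exact: virtual_cusps_at_ge0.
  by apply: fsume_ge0 => p _; exact: virtual_nodes_at_ge0.
move=> cF; split.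
  (* A cusp contributes 1 and a node 0, and there are no other singular points. For virtual nodes
     the roles are exchanged. *)
  rewrite /virtual_cusps (@fsbig_indicator _ _ _ _ _ (cusps F) _ 1) //.
  - by rewrite big_const_seq count_predT iter_addr_0 natz.
  - by move=> p [].
  - by move=> p [_ /ordinary_cusp_invariants []].
  - by move=> p /cF [|[_ /ordinary_node_invariants []]].
rewrite /virtual_nodes (@fsbig_indicator _ _ _ _ _ (nodes F) _ 1%:E) //.
- by rewrite sumEFin big_const_seq count_predT iter_addr_0.
- by case=> /eqP; rewrite oner_eq0.
- by move=> p [].
- by move=> p [_ /ordinary_node_invariants []].
- by move=> p /cF [[_ /ordinary_cusp_invariants []]|].
Qed.
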